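(* In the Fraunhofer regime, consider a single dipole at $\mathbf y_*=(\mathbf y_{*,\parallel},L+\eta_* )$ with polarizability tensor $\boldsymbol\alpha_*$, and an imaging point $\mathbf y=(\mathbf y_\parallel,L+\eta_* )$ in the imaging window. The Kirchhoff imaging function satisfies: (i) if $\mathbf y_\parallel\ne\mathbf y_{*,\parallel}$, then for any matrix norm $$\|\mathcal I_{KM}(\mathbf y;k)\|=\frac1{(4\pi L)^2}\left[\frac{a^2}{L^2}\left(\mathcal O\left(\frac{L}{a\,k\,|\mathbf y_\parallel-\mathbf y_{*,\parallel}|}\right)+o(1)\right)\right],$$ where $o(1)$ is explicitly $\mathcal O(a^2\Theta_a/L^2)+\mathcal O(\Theta_b)+\mathcal O(a/L)$; (ii) if $\mathbf y_\parallel=\mathbf y_{*,\parallel}$ (so $\mathbf y=\mathbf y_*$), then $$\mathcal I_{KM}(\mathbf y_*;k)=\frac1{(4\pi L)^2}\left[\frac{\operatorname{mes}\mathcal A}{(4\pi L)^2}\,\mathbf P_\parallel\,\boldsymbol\alpha_*\,\mathbf P_s+o\left(\frac{a^2}{L^2}\right)\right],$$ where $\operatorname{mes}\mathcal A=\Theta(a^2)$ is the area of the array.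
   Context: Points of $\mathbb R^3$ are written $\mathbf x=(\mathbf x_\parallel,x_3)$. For $k>0$, $\mathbf r=\mathbf x-\mathbf y\neq 0$, $r=|\mathbf r|$, the dyadic Green function is $$\mathbf G(\mathbf x,\mathbf y;k)=\frac{e^{\imath kr}}{4\pi r}\left[(1+m(kr))\mathbf I-(1+3m(kr))\frac{\mathbf r\mathbf r^\top}{r^2}\right],\quad m(kr)=\frac{\imath kr-1}{(kr)^2}.$$ The array is $\mathcal A=a\widetilde{\mathcal A}$, contained in the plane $x_3=0$ (identified with $\mathbb R^2$), where the shape $\widetilde{\mathcal A}$ is a fixed bounded planar domain with piecewise smooth boundary (e.g. a unit square centered at the origin). So $|\mathbf x_{r,\parallel}|=\mathcal O(a)$ on $\mathcal A$. The dipole and imaging points $\mathbf y=(\mathbf y_\parallel,L+\eta)$ lie in an imaging window where $|\mathbf y_\parallel|=\mathcal O(b)$, $|\eta|=\mathcal O(h)$. The source $\mathbf x_s$ satisfies $|\mathbf x_s-\mathbf y_0|=L$ where $\mathbf y_0=(0,0,L)$. The polarizability tensor $\boldsymbol\alpha_*$ is a $3\times3$ complex symmetric matrix with $\|\boldsymbol\alpha_*\|=\mathcal O(1)$. Full data and imaging function: $\boldsymbol\Pi(\mathbf x_r,\mathbf x_s;k)=\mathbf G(\mathbf x_r,\mathbf y_*;k)\boldsymbol\alpha_*\mathbf G(\mathbf y_*,\mathbf x_s;k)$ and $$\mathcal I_{KM}(\mathbf y;k)=\int_{\mathcal A}d\mathbf x_{r,\parallel}\,\overline{\mathbf G(\mathbf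 x_r,\mathbf y;k)}\,\boldsymbol\Pi(\mathbf x_r,\mathbf x_s;k)\,\overline{\mathbf G(\mathbf x_s,\mathbf y;k)}.$$ $\mathbf P_\parallel$ is the orthogonal projector onto $\operatorname{span}(\mathbf e_1,\mathbf e_2)$, $\mathbf P_s$ the orthogonal projector onto $(\mathbf y_0-\mathbf x_s)^\perp$. Fraunhofer regime: with $\Theta_a=ka^2/L$, $\Theta_b=kb^2/L$, $\Theta_h=kh^2/L$, one assumes $kL\gg1$, $a\ll L$, $b\ll L$, $h\ll L$ (equivalently $\Theta_a,\Theta_b,\Theta_h\ll kL$), $\Theta_b\ll1$, $1\ll\Theta_a\ll L^2/a^2$ (so $b\ll a$), and $kh=\mathcal O(1)$. Here $\ll$ means that the ratio tends to $0$; $\mathcal O$ constants are independent of $k,L,a,b,h$ and of the points considered; $o(\cdot)$ is understood in this regime; $f=\Theta(g)$ means $cg\le f\le Cg$ for constants $c,C>0$. *)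

(* Defs.v *)
From HB Require Import structures.
From mathcomp Require Import all_boot all_order all_algebra.
From mathcomp Require Import all_classical all_reals all_analysis.
From mathcomp Require Import complex.

Set Implicit Arguments.
Unset Strict Implicit.
Unset Printing Implicit Defensive.

Import Order.TTheory GRing.Theory Num.Theory.
Import numFieldNormedType.Exports.

Local Open Scope classical_set_scope.
Local Open Scope ring_scope.

(** Everything is stated over an arbitrary [R : realType]. The plane
    [x_3 = 0] is [R * R], points of R^3 are row vectors ['rV[R]_3] (so the dyad
    r r^T of a column vector is written [r^T *m r]), and the field of complex
    numbers is [R[i]]. The sup norms that the library puts on products and
    matrices are not used: distances are Euclidean. *)

Section Geometry.
Context {R : realType}.

Definition enorm2 (p : R * R) : R := Num.sqrt (p.1 ^+ 2 + p.2 ^+ 2).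

Definition enorm3 (v : 'rV[R]_3) : R := Num.sqrt (\sum_(i < 3) v 0 i ^+ 2).

Definition point3 (p : R * R) (z : R) : 'rV[R]_3 :=
  \row_(i < 3) [:: p.1; p.2; z]`_i.

(** A curve of class C^1 up to the end points, with nonvanishing velocity. A
    C^1 curve on [0, 1] extends to a C^1 curve on the line, so that asking for
    the parametrization on the whole line is no restriction; only [0, 1] is
    used. *)
Definition regular_curve (g : R -> R * R) : Prop :=
  let g1 : R -> R := fun t => (g t).1 in
  let g2 : R -> R := fun t => (g t).2 in
  [/\ forall t, derivable g1 t 1 /\ derivable g2 t 1,
      continuous (derive1 g1), continuous (derive1 g2) &
      forall t, 0 <= t <= 1 -> (derive1 g1 t != 0) || (derive1 g2 t != 0)].

(** The boundary of the open set [D], i.e. [closure D `\` D], is a finite union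
    of regular curves. Nothing is asked about how the curves meet, which only
    makes the class of domains larger than that of regions bounded by
    piecewise smooth Jordan curves. *)
Definition piecewise_smooth_domain (D : set (R * R)) : Prop :=
  [/\ open D, connected D, D !=set0,
      exists M : R, forall p, D p -> enorm2 p <= M &
      exists (n : nat) (g : 'I_n -> R -> R * R),
        (forall i, regular_curve (g i)) /\
        closure D `\` D =
          [set p | exists i t, 0 <= t <= 1 /\ p = g i t]].

Definition array (a : R) (D : set (R * R)) : set (R * R) :=
  [set (a * p.1, a * p.2) | p in D].

Definition area (A : set (R * R)) : R :=
  fine ((@lebesgue_measure R \x @lebesgue_measure R)%E A).

End Geometry.

Section Imaging.
Context {R : realType}.
Local Open Scope complex_scope.

Definition cis (t : R) : R[i] := cos t +i* sin t.

Definition conjmx (M : 'M[R[i]]_3) : 'M[R[i]]_3 := map_mx conjc M.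

Definition mcoef (z : R) : R[i] := ('i * z%:C - 1) / (z ^+ 2)%:C.

Definition Green (x y : 'rV[R]_3) (k : R) : 'M[R[i]]_3 :=
  let v := x - y in
  let r := enorm3 v in
  (cis (k * r) / (4 * pi * r)%:C) *:
    ((1 + mcoef (k * r))%:M
     - ((1 + 3 * mcoef (k * r)) / (r ^+ 2)%:C)
         *: map_mx (real_complex R) (v^T *m v)).

Definition data (alpha : 'M[R[i]]_3) (ystar xr xs : 'rV[R]_3) (k : R) :
    'M[R[i]]_3 :=
  Green xr ystar k *m alpha *m Green ystar xs k.

(** Entrywise integral of a matrix-valued function on the plane. *)
Definition integralmx (A : set (R * R)) (F : R * R -> 'M[R[i]]_3) :
    'M[R[i]]_3 :=
  \matrix_(i, j)
    (Rintegral (@lebesgue_measure R \x @lebesgue_measure R)%E A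
       (fun p => complex.Re (F p i j))
     +i* Rintegral (@lebesgue_measure R \x @lebesgue_measure R)%E A
       (fun p => complex.Im (F p i j))).

Definition kirchhoff (A : set (R * R)) (alpha : 'M[R[i]]_3)
    (ystar xs y : 'rV[R]_3) (k : R) : 'M[R[i]]_3 :=
  integralmx A (fun p =>
    let xr := point3 p 0 in
    conjmx (Green xr y k) *m data alpha ystar xr xs k
      *m conjmx (Green xs y k)).

(** [proj_ortho U] acts on rows and projects onto the row space of [U]; being
    symmetric for real [U], it is also the matrix acting on columns. *)
Definition Ppar : 'M[R[i]]_3 :=
  proj_ortho (\matrix_(i < 2, j < 3) (i == j :> nat)%:R).

Definition Pperp (v : 'rV[R]_3) : 'M[R[i]]_3 :=
  proj_ortho (orthomx Num.conj (mx_of_hermitian (hermitian1mx 3))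
                (map_mx (real_complex R) v)).

(** Norms on the vector space of complex 3 x 3 matrices; submultiplicativity is
    not required. *)
Definition matrix_norm (N : 'M[R[i]]_3 -> R) : Prop :=
  [/\ forall M, N M = 0 -> M = 0,
      forall c M, N (c *: M) = Normc.normc c * N M &
      forall M M', N (M + M') <= N M + N M'].

End Imaging.

Section Regime.
Context {R : realType}.

Record params := Params {
  par_k : R;
  par_L : R;
  par_a : R;
  par_b : R;
  par_h : R }.

Implicit Type p : params.

Definition Theta_a p : R := par_k p * par_a p ^+ 2 / par_L p.
Definition Theta_b p : R := par_k p * par_b p ^+ 2 / par_L p.

Definition fraunhofer_set (Ckh d : R) : set params :=
  [set p |
    [/\ 0 < par_k p, 0 < par_L p, 0 < par_a p, 0 < par_b p
      & 0 < par_h p] /\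
    [/\ 1 / (par_k p * par_L p) < d,
        par_a p / par_L p < d,
        par_b p / par_L p < d
      & par_h p / par_L p < d] /\
    [/\ Theta_b p < d,
        1 / Theta_a p < d,
        Theta_a p / (par_L p ^+ 2 / par_a p ^+ 2) < d
      & par_k p * par_h p <= Ckh]].

(** The Fraunhofer regime as a filter on the parameters (k, L, a, b, h): each
    relation f << g says that f / g tends to 0 along the filter, and the bound
    [k * h <= Ckh] is the relation k h = O(1) with constant [Ckh]. An O or o
    along this filter has constants depending on no parameter. *)
Definition fraunhofer (Ckh : R) : set_system params :=
  filter_from [set d : R | 0 < d] (fraunhofer_set Ckh).

Definition remainder p : R :=
  par_a p ^+ 2 * Theta_a p / par_L p ^+ 2 + Theta_b p
  + par_a p / par_L p.

Global Instance fraunhofer_filter (Ckh : R) : Filter (fraunhofer Ckh).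
Proof.
apply: filter_from_filter; first by exists 1; exact: ltr01.
move=> d e /= d0 e0; exists (Num.min d e) => /=; first by rewrite lt_min d0.
by move=> p [? [[]]]; rewrite !lt_min => /andP[? ?] /andP[? ?] /andP[? ?]
  /andP[? ?] [/andP[? ?] /andP[? ?] /andP[? ?] ?].
Qed.

(** The regime is not void. *)
Lemma fraunhofer_proper (Ckh : R) : 0 < Ckh -> ProperFilter (fraunhofer Ckh).
Proof.
move=> C0; apply: filter_from_proper => d /= d0.
pose s : R := (1 + Ckh + d^-1)^-1.
have di0 : 0 < d^-1 by rewrite invr_gt0.
have s0 : 0 < s by rewrite invr_gt0 !addr_gt0.
have s1 : s < 1.
  by rewrite invf_lt1 ?addr_gt0// -addrA ltrDl addr_gt0.
have sd : s < d.
  by rewrite -[ltRHS]invrK ltf_pV2 ?posrE ?addr_gt0// ltrDr addr_gt0.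
have sC : Ckh * s < 1.
  by rewrite ltr_pdivrMr ?addr_gt0// mul1r -addrA addrCA ltrDl addr_gt0.
have sn (n : nat) : s ^+ n.+1 < d.
  by rewrite (le_lt_trans _ sd)// exprS ger_pMr// exprn_ile1// ltW.
have su : s != 0 by rewrite gt_eqF.
exists (Params (s ^- 8) 1 (s ^+ 3) (s ^+ 8) (Ckh * s ^+ 8)).
rewrite /fraunhofer_set /Theta_a /Theta_b /= !divr1 !mulr1 !expr1n -!exprM.
split; first by split; rewrite ?invr_gt0 ?mulr_gt0 ?exprn_gt0.
split; split.
- by rewrite mul1r invrK.
- exact: sn.
- exact: sn.
- rewrite (exprS s 7) mulrA (lt_trans _ (sn 6%N))//.
  by rewrite gtr_pMl ?exprn_gt0.
- rewrite (_ : _ * _ = s ^+ 8) ?sn// (exprD s 8 8) mulrA mulVf ?mul1r//.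
  by rewrite expf_neq0.
- rewrite mul1r (_ : _^-1 = s ^+ 2) ?sn// (exprD s 6 2) invfM invrK.
  by rewrite mulrAC mulfV ?mul1r ?expf_neq0.
- rewrite mul1r invrK (_ : _ * _ * _ = s ^+ 4) ?sn// -mulrA -exprD.
  by rewrite (exprD s 8 4) mulrA mulVf ?mul1r ?expf_neq0.
- by rewrite mulrCA mulVf ?mulr1 ?expf_neq0.
Qed.

End Regime.
Arguments params : clear implicits.

(* Main.v *)
(* The Green functions in the integrand have amplitudes which, once multiplied by
   L, are within O(a/L) of the orthogonal projectors Ppar and Ps, because every
   displacement involved is O(a) and because 1/(kL) and h/L are O(a/L) in the
   regime. The phases from the array combine into
     k (|x - ystar| - |x - y|) = (k/Z) x . (ypar - ystarpar)
                                 + O(Theta_b) + O(a^2 Theta_a / L^2),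
   where Z is the common depth of y and ystar. So the imaging function is
   Ppar alpha Ps times a number of modulus 1/(4 pi L)^4 times
   J = int_A exp(i xi . x) dx with xi = (k/Z) (ypar - ystarpar), up to an error of
   order (a^2/L^4) remainder. If y = ystar, then J is the area of A and all phases
   cancel. Otherwise J = O(a/|xi|): a translation by v = pi xi/|xi|^2 changes the
   sign of the integrand, so |2 J| is at most the measure of the symmetric
   difference of A and its translate, which lies in the |v|-neighbourhood of the
   boundary; the boundary consists of finitely many Lipschitz curves, so it is
   covered by O(a/|v|) squares of side O(|v|). *)
Require Import Defs.
From HB Require Import structures.
From mathcomp Require Import all_boot all_order all_algebra.
From mathcomp Require Import all_classical all_reals all_analysis.
From mathcomp Require Import measurable_realfun complex ring lra.

Import Order.TTheory GRing.Theory Num.Theory.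
Import numFieldNormedType.Exports.

Local Open Scope classical_set_scope.
Local Open Scope ring_scope.

Set Implicit Arguments.
Unset Strict Implicit.
Unset Printing Implicit Defensive.

(** * Lebesgue measure of the plane *)

(** Everything is measured on the single scale [c1 * (a / L)]. This is possible because
    [1 < Theta_a] and [a < L] force [k * a >= 1], which dominates [1 / (k * L)] by [a / L] and [h]
    by a multiple of [a], while comparing [Theta_b] with [Theta_a] gives [b <= a]. Both projectors
    have the form I - v v^T / |v|^2, which is what the bracket of the Green function becomes at m =
    0, so that one estimate serves all four Green functions. These stand in pairs on either side of
    [alpha]; a pair collapses to one projector by idempotence, and conjugation is harmless because
    the projectors are real. Since [y] and [ystar] share their depth, it cancels from |x - ystar|^2
    - |x - y|^2: no phase of order k h survives, although k h is only bounded and not small. An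
    arbitrary [N] need not be submultiplicative, so products are estimated in the entrywise l^1
    norm. Equivalence of norms is used in both directions: to bound [alpha] from [N alpha], and to
    return to [N] at the end. *)

Section PlaneMeasure.
Context {R : realType}.
Local Notation plane := (measurableTypeR R * measurableTypeR R)%type.
Local Notation leb := (@lebesgue_measure R).
Local Notation leb2 := (leb \x leb)%E.

(** A measure that gives every half-open interval its length is Lebesgue measure; the image measure
    under a translation is tested on such intervals. *)
Lemma lebesgue_measure_shift (t : R) (A : set R) : measurable A ->
  leb ((fun x => x + t) @^-1` A) = leb A.
Proof.
move=> mA.
have ms : measurable_fun setT ((fun x => x + t) : measurableTypeR R -> measurableTypeR R).
  exact: measurable_funD.
pose phi : {mfun measurableTypeR R >-> measurableTypeR R} :=
  HB.pack (fun x : measurableTypeR R => x + t : measurableTypeR R)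
    (isMeasurableFun.Build _ _ _ _ _ ms).
apply/esym.
apply: (@lebesgue_measure_unique R (pushforward leb phi) _ A mA).
move=> _ [[a b]] _ <-.
have E : (fun x => x + t) @^-1` `]a, b]%classic = `](a - t), (b - t)]%classic.
  by apply/seteqP; split => x /=; rewrite !in_itv /= ltrBlDr lerBrDr.
rewrite -[RHS]/(leb ((fun x => x + t) @^-1` `]a, b]%classic)) E.
rewrite !lebesgue_measure_itv /= !lte_fin ltrD2r.
case: ifPn => // _; rewrite -EFinD; congr _%:E; lra.
Qed.

Lemma measurable_shift (v : R * R) :
  measurable_fun setT (fun p : plane =>
    (p + v : plane)).
Proof.
apply/measurable_fun_pairP; split => /=.
- rewrite (_ : _ \o _ = (fun p => p.1 + v.1)); last by apply/funext.
  by apply: measurable_funD => //; exact: measurable_fst.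
- rewrite (_ : _ \o _ = (fun p => p.2 + v.2)); last by apply/funext.
  by apply: measurable_funD => //; exact: measurable_snd.
Qed.

(** The product measure is determined by its values on measurable rectangles, and translating a
    rectangle translates its sides. *)
Lemma lebesgue_plane_shift (v : R * R)
    (A : set (plane)) : measurable A ->
  leb2 ((fun p => p + v) @^-1` A) = leb2 A.
Proof.
move=> mA.
pose phi : {mfun plane >-> plane} :=
  HB.pack (fun p : plane => p + v : plane)
    (isMeasurableFun.Build _ _ _ _ _ (measurable_shift v)).
apply/esym.
apply: (@product_measure_unique _ _ _ _ _ leb leb (pushforward leb2 phi) _ A mA).
move=> X Y mX mY.
have E : (fun p => p + v) @^-1` (X `*` Y) =
    ((fun x => x + v.1) @^-1` X) `*` ((fun x => x + v.2) @^-1` Y).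
  by apply/seteqP; split => -[x y].
rewrite -[LHS]/(leb2 ((fun p => p + v) @^-1` (X `*` Y))) E.
rewrite product_measure1E.
- by congr (_ * _)%E; exact: lebesgue_measure_shift.
- by rewrite -[X in measurable X]setTI; exact: measurable_funD.
- by rewrite -[X in measurable X]setTI; exact: measurable_funD.
Qed.

(** The plane carries the product sigma-algebra, so an open set is written as a countable union of
    rectangles. Balls are those of the sup norm, hence products of intervals; [F q] is the rational
    ball coded by [q] if it lies in [D], and empty otherwise. *)
Lemma open_measurable_plane (D : set (R * R)) : open D ->
  measurable (D : set (plane)).
Proof.
move=> oD.
pose F (q : rat * rat * rat) : set (R * R) :=
  let B := ball ((ratr q.1.1, ratr q.1.2) : R * R) (ratr q.2) in
  [set p | B p /\ B `<=` D].
have -> : D = \bigcup_q F q.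
  apply/seteqP; split => [p Dp|p [q _ []]]; last by move=> Bp; apply.
  have /nbhs_ballP[e /= e0 pe] : nbhs p D by apply: open_nbhs_nbhs.
  have [r] : exists r : rat, ratr r \in `]0, (e / 2)[.
    by apply: rat_in_itvoo; rewrite divr_gt0.
  rewrite in_itv /= => /andP[r0 re].
  have rat_near (x : R) : exists q : rat, ball x (ratr r) (ratr q : R).
    have [q] : exists q : rat, ratr q \in `](x - ratr r), x[.
      by apply: rat_in_itvoo; lra.
    by rewrite in_itv /= => /andP[qx xq]; exists q; rewrite /ball/= ltr_norml; lra.
  have [q1 h1] := rat_near p.1; have [q2 h2] := rat_near p.2.
  exists (q1, q2, r) => //; split => /=; first by split => /=; exact: ball_sym.
  move=> z [z1 z2]; apply: pe; split => /=.
  - by have := ball_triangle h1 z1; apply: le_ball; lra.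
  - by have := ball_triangle h2 z2; apply: le_ball; lra.
apply: countable_bigcupT_measurable; first exact: countableP.
move=> [[q1 q2] r] /=.
have [BD|nBD] := pselect (ball ((ratr q1, ratr q2) : R * R) (ratr r) `<=` D).
  rewrite (_ : F _ = ball (ratr q1 : R) (ratr r) `*` ball (ratr q2 : R) (ratr r)).
    by apply: measurableX; exact: measurable_ball.
  by apply/seteqP; split => [[x y] [] []|[x y] []].
rewrite (_ : F _ = set0); first exact: measurable0.
by apply/seteqP; split => // x [].
Qed.

Definition box (c : R * R) (r : R) : set (R * R) :=
  `[c.1 - r, c.1 + r]%classic `*` `[c.2 - r, c.2 + r]%classic.

Lemma measurable_box c r :
  measurable (box c r : set (plane)).
Proof. by apply: measurableX; exact: measurable_itv. Qed.

Lemma lebesgue_box c r : 0 <= r -> leb2 (box c r) = (4 * r ^+ 2)%:E.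
Proof.
move=> r0; rewrite product_measure1E; try exact: measurable_itv.
have E x : leb `[(x - r), (x + r)]%classic = (2 * r)%:E.
  rewrite lebesgue_measure_itv /= lte_fin -EFinB.
  by case: ifPn => h; congr _%:E; lra.
transitivity ((2 * r)%:E * (2 * r)%:E)%E; first by congr (_ * _)%E; exact: E.
by rewrite -EFinM; congr _%:E; ring.
Qed.

End PlaneMeasure.

(** * Covering a neighbourhood of a piecewise smooth boundary *)

Section BoundaryNeighbourhood.
Context {R : realType}.
Local Notation leb := (@lebesgue_measure R).
Local Notation leb2 := (leb \x leb)%E.
Local Notation plane := (measurableTypeR R * measurableTypeR R)%type.

(** Mean value theorem with the maximum of the derivative in absolute value; adding 1 to it keeps
    [M] positive when [f] is constant. *)
Lemma lipschitz_unit_interval (f : R -> R) :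
  (forall t, derivable f t 1) -> continuous (derive1 f) ->
  exists2 M, 0 < M & forall s t, 0 <= s <= 1 -> 0 <= t <= 1 ->
    `|f s - f t| <= M * `|s - t|.
Proof.
move=> df cf'.
have [c c01 cmax] : exists2 c, c \in `[0, 1]%R &
    forall t, t \in `[0, 1]%R -> `|derive1 f t| <= `|derive1 f c|.
  apply: (@EVT_max R (fun t => `|derive1 f t|)) => //.
  apply: continuous_subspaceT => x.
  by apply: continuous_comp; [exact: cf'|exact: norm_continuous].
exists (`|derive1 f c| + 1); first by rewrite ltr_wpDl.
have main s t : 0 <= s -> s <= t -> t <= 1 ->
    `|f t - f s| <= (`|derive1 f c| + 1) * `|t - s|.
  move=> s0 st t1.
  have [u us ->] : exists2 u, u \in `[s, t] & f t - f s = derive1 f u * (t - s).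
    apply: MVT_segment => //.
      by move=> x _; rewrite derive1E; exact/derivableP/df.
    apply: continuous_subspaceT => x.
    by apply/differentiable_continuous/derivable1_diffP/df.
  rewrite normrM ler_wpM2r//.
  move: us; rewrite in_itv /= => /andP[su ut].
  by rewrite ler_wpDr// cmax// in_itv/= (le_trans s0 su) (le_trans ut t1).
move=> s t /andP[s0 s1] /andP[t0 t1]; have [st|/ltW ts] := leP s t.
  by rewrite distrC (distrC s); exact: main.
exact: main.
Qed.

(** The curve is sampled at [K + 1] equally spaced parameters, with [K] just above [M / d], so that
    every curve point is within [d] of a sample in each coordinate. About [M / d] squares of area of
    order [(a * d) ^+ 2] then suffice, which is linear in [d]. *)
Lemma curve_nbhd_cover (g : R -> R * R) : regular_curve g ->
  exists2 C, 0 < C & forall a d, 0 < a -> 0 < d <= 1 ->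
    exists U : set plane,
    [/\ measurable U, (leb2 U <= (C * a ^+ 2 * d)%:E)%E &
        forall p t, 0 <= t <= 1 -> `|p.1 - a * (g t).1| <= a * d ->
          `|p.2 - a * (g t).2| <= a * d -> U p].
Proof.
move=> [dg c1 c2 _].
have [M1 M10 h1] := lipschitz_unit_interval (fun t => proj1 (dg t)) c1.
have [M2 M20 h2] := lipschitz_unit_interval (fun t => proj2 (dg t)) c2.
have [M [M0 M1M M2M]] : exists M, [/\ 0 < M, M1 <= M & M2 <= M].
  by exists (M1 + M2); rewrite addr_gt0//; split => //; lra.
exists (16 * (M + 2)); first by rewrite mulr_gt0 ?addr_gt0.
move=> a d a0 /andP[d0 d1].
pose K := (Num.truncn (M / d)).+1.
have K0 : (0 : R) < K%:R by rewrite ltr0n.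
have MK : M / K%:R <= d.
  rewrite ler_pdivrMr// mulrC -ler_pdivrMr//.
  exact/ltW/truncnS_gt.
(* [K.+1] is the integer part of [M / d] plus 2, so the product is at most [M + 2 * d]; [d <= 1] is
   used here. *)
have Kd : K.+1%:R * d <= M + 2.
  have : (Num.truncn (M / d))%:R <= M / d by rewrite truncn_le divr_ge0// ltW.
  rewrite ler_pdivlMr// => h.
  have -> : K.+1%:R = (Num.truncn (M / d))%:R + 1 + 1 :> R by rewrite /K !natr1.
  lra.
(* Half-side [2 * (a * d)]: one [a * d] from the point to the curve, one along the curve to the
   nearest earlier sample. *)
pose V j := box (a * (g (j%:R / K%:R)).1, a * (g (j%:R / K%:R)).2) (2 * (a * d)).
exists (\big[setU/set0]_(j < K.+1) V j); split.
- by apply: bigsetU_measurable => j _; exact: measurable_box.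
- apply: (@le_trans _ _ (\sum_(j < K.+1) leb2 (V j))%E).
    apply: (@content_subadditive _ _ plane leb2 _ V K.+1) => //.
      by move=> j _; exact: measurable_box.
    by apply: bigsetU_measurable => j _; exact: measurable_box.
  under eq_bigr do rewrite lebesgue_box ?mulr_ge0// ?ltW//.
  rewrite sumEFin lee_fin sumr_const card_ord -[leLHS]mulr_natr.
  have -> : 4 * (2 * (a * d)) ^+ 2 * K.+1%:R = 16 * a ^+ 2 * d * (K.+1%:R * d) by ring.
  rewrite (_ : 16 * (M + 2) * a ^+ 2 * d = 16 * a ^+ 2 * d * (M + 2)); last by ring.
  by apply: ler_wpM2l => //; rewrite !mulr_ge0 ?exprn_ge0// ltW.
move=> p t /andP[t0 t1] p1 p2.
pose j := Num.truncn (t * K%:R).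
have jt : j%:R <= t * K%:R by rewrite truncn_le mulr_ge0// ltW.
have tj : t * K%:R < j.+1%:R by exact: truncnS_gt.
have jK : (j < K.+1)%N.
  rewrite ltnS -(@ler_nat R); apply: (le_trans jt).
  by rewrite ler_piMl// ltW.
have jK1 : 0 <= (j%:R / K%:R : R) <= 1.
  by rewrite divr_ge0//= ler_pdivrMr// mul1r ler_nat -ltnS.
have tjK : `|t - j%:R / K%:R| <= K%:R^-1.
  have e : t - j%:R / K%:R = (t * K%:R - j%:R) / K%:R.
    by rewrite mulrBl mulfK// gt_eqF.
  rewrite e normrM normfV (ger0_norm (ltW K0)) ler_pdivrMr// mulVf ?gt_eqF//.
  by rewrite ger0_norm; [move: tj; rewrite -natr1; lra|lra].
have t01 : 0 <= t <= 1 by rewrite t0.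
have near N : 0 < N -> N <= M -> N * `|t - j%:R / K%:R| <= d.
  move=> N0 NM; apply: le_trans MK; apply: ler_pM => //; exact: ltW.
have H (x y z : R) : `|x - a * y| <= a * d -> `|y - z| <= d ->
    x \in `[a * z - 2 * (a * d), a * z + 2 * (a * d)].
  move=> hx hy; have : `|a * (y - z)| <= a * d.
    by rewrite normrM (gtr0_norm a0) ler_wpM2l// ltW.
  rewrite in_itv /=; move: hx; rewrite !ler_norml mulrBr; lra.
rewrite -bigcup_mkord; exists j => //=; split => /=.
- apply: (H _ _ _ p1); apply: (le_trans (h1 _ _ t01 jK1)).
  exact: near.
- apply: (H _ _ _ p2); apply: (le_trans (h2 _ _ t01 jK1)).
  exact: near.
Qed.

Lemma curves_nbhd_cover (n : nat) (g : 'I_n -> R -> R * R) :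
  (forall i, regular_curve (g i)) ->
  exists2 C, 0 < C & forall a d, 0 < a -> 0 < d <= 1 ->
    exists U : set plane,
    [/\ measurable U, (leb2 U <= (C * a ^+ 2 * d)%:E)%E &
        forall p i t, 0 <= t <= 1 -> `|p.1 - a * (g i t).1| <= a * d ->
          `|p.2 - a * (g i t).2| <= a * d -> U p].
Proof.
elim: n g => [g _|n IH g rg].
  exists 1 => // a d a0 /andP[d0 _]; exists set0; split => //; last by move=> p [].
  by rewrite measure0 lee_fin !mulr_ge0 ?exprn_ge0 ?ltW.
have [C C0 hC] := curve_nbhd_cover (rg ord0).
have [C' C'0 hC'] := IH (fun i => g (lift ord0 i)) (fun i => rg _).
exists (C + C'); first exact: addr_gt0.
move=> a d a0 d01.
have [U [mU U1 U2]] := hC a d a0 d01.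
have [U' [mU' U'1 U'2]] := hC' a d a0 d01.
exists (U `|` U'); split; first exact: measurableU.
  apply: (le_trans (measureU2 _ mU mU')).
  by rewrite !mulrDl EFinD; exact: leeD.
move=> p i t t01; have [j ->|->] := unliftP ord0 i.
  by move=> p1 p2; right; apply: (U'2 _ j t).
by move=> p1 p2; left; apply: (U2 _ t).
Qed.

(** The crossing is at the first parameter [s0] outside [D]. Openness of [D] shows that [s0] itself
    is outside, and points just before [s0] are inside, which puts [f s0] in the closure. *)
Lemma segment_crosses_boundary (D : set (R * R)) (x y : R * R) :
  open D -> D x -> ~ D y ->
  exists2 s, 0 <= s <= 1 & (closure D `\` D) (x + s *: (y - x)).
Proof.
move=> oD Dx nDy.
pose f (s : R) : R * R := x + s *: (y - x).
have cf : continuous f.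
  move=> s; apply: cvgD; first exact: cvg_cst.
  by apply: cvgZr_tmp; exact: cvg_id.
have f0 : f 0 = x by rewrite /f scale0r addr0.
have f1 : f 1 = y by rewrite /f scale1r addrC subrK.
pose T := [set s | 0 <= s <= 1 /\ ~ D (f s)].
have T1 : T 1 by split; rewrite ?f1// ler01 lexx.
have lbT : lbound T 0 by move=> s [/andP[]].
have hT : has_inf T by split; [exists 1|exists 0].
pose s0 := inf T.
have s00 : 0 <= s0 by apply: lb_le_inf => //; exists 1.
have s01 : s0 <= 1 by apply: ge_inf => //; exists 0.
have nD : ~ D (f s0).
  move=> Dfs.
  have /nbhs_ballP[e /= e0 eD] : nbhs s0 (f @^-1` D).
    by apply: cf; apply: open_nbhs_nbhs.
  have [t Tt ts] := inf_adherent e0 hT.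
  have t0 : s0 <= t by apply: ge_inf => //; exists 0.
  have [_] := Tt; apply; apply: eD.
  by rewrite /ball /= distrC ger0_norm ?subr_ge0// ltrBlDl.
have s0gt : 0 < s0.
  by rewrite lt_neqAle s00 andbT eq_sym; apply/eqP => E; apply: nD; rewrite E f0.
exists s0; first by rewrite s00.
split => // B nB.
have /nbhs_ballP[e /= e0 eB] : nbhs s0 (f @^-1` B) by exact: cf.
(* A parameter just before [s0]; the maximum with 0 keeps it on the segment. *)
pose s := Num.max 0 (s0 - e / 2).
have e20 : 0 < e / 2 by rewrite divr_gt0.
have ss0 : s < s0 by rewrite gt_max s0gt; lra.
have s_ge0 : 0 <= s by rewrite le_max lexx.
exists (f s); split.
  apply: contrapT => nDs.
  have : s0 <= s.
    by apply: ge_inf; [exists 0|split => //; rewrite s_ge0/= (le_trans (ltW ss0))].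
  by rewrite leNgt ss0.
apply: eB; rewrite /ball /= ger0_norm ?subr_ge0 ?ltW//.
have : s0 - e / 2 <= s by rewrite le_max lexx orbT.
lra.
Qed.

End BoundaryNeighbourhood.

(** * Oscillatory integrals over the array *)

Section OscillatoryIntegral.
Context {R : realType}.
Local Notation leb := (@lebesgue_measure R).
Local Notation leb2 := (leb \x leb)%E.
Local Notation plane := (measurableTypeR R * measurableTypeR R)%type.

Lemma enorm2_le (p : R * R) : `|p.1| <= enorm2 p /\ `|p.2| <= enorm2 p.
Proof.
split; rewrite -sqrtr_sqr ler_wsqrtr//; first by rewrite lerDl sqr_ge0.
by rewrite lerDr sqr_ge0.
Qed.

Lemma enorm2_gt0 (w : R * R) : w != 0 -> 0 < enorm2 w.
Proof.
move=> w0; rewrite sqrtr_gt0 lt_neqAle addr_ge0 ?sqr_ge0// andbT eq_sym.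
rewrite paddr_eq0 ?sqr_ge0// !sqrf_eq0; apply: contra w0 => /andP[/eqP w1 /eqP w2].
by rewrite [w]surjective_pairing w1 w2.
Qed.

Section Bounded.
Variables (A : set plane) (mA : measurable A) (Aoo : (leb2 A < +oo)%E).

Lemma bounded_integrable (f : plane -> R) (c : R) :
  measurable_fun setT f -> (forall p, A p -> `|f p| <= c) ->
  leb2.-integrable A (EFin \o f).
Proof.
move=> mf fc; apply: measurable_bounded_integrable => //.
  exact: measurable_funTS.
exists c; split; first exact: num_real.
by move=> M cM p Ap /=; rewrite (le_trans (fc p Ap))// ltW.
Qed.

Lemma le_normr_bounded_Rintegral (f : plane -> R) (c : R) :
  measurable_fun setT f -> (forall p, A p -> `|f p| <= c) ->
  `|Rintegral leb2 A f| <= c * area A.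
Proof.
move=> mf fc.
have ff := bounded_integrable mf fc.
apply: (le_trans (le_normr_Rintegral mA ff)).
rewrite -(Rintegral_cst leb2 mA c); apply: le_Rintegral => //.
- exact: integrable_norm.
- apply: (@bounded_integrable _ `|c|) => //; exact: measurable_cst.
Qed.

End Bounded.

(** Change of variables for an image measure that is the measure itself; the bound on [f] and the
    finite measure of [A] supply integrability. *)
Lemma Rintegral_shift (A : set plane) (f : plane -> R) (c : R) (v : R * R) :
  measurable A -> (leb2 A < +oo)%E -> measurable_fun setT f ->
  (forall p, `|f p| <= c) ->
  Rintegral leb2 A f =
  Rintegral leb2 ((fun p => p + v) @^-1` A) (fun p => f (p + v)).
Proof.
move=> mA Aoo mf fc; rewrite /Rintegral; congr fine.
have mfv : measurable_fun setT (fun p : plane => f (p + v)).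
  by apply: (measurableT_comp mf); exact: measurable_shift.
have int_fv : leb2.-integrable ((fun p : plane => p + v) @^-1` A)
    ((EFin \o f) \o (fun p : plane => p + v)).
  apply: (@bounded_integrable _ _ _ (fun p => f (p + v)) c) => //.
  - by rewrite -[X in measurable X]setTI; exact: measurable_shift.
  - by rewrite lebesgue_plane_shift.
have mEf : measurable_fun setT (EFin \o f : plane -> \bar R) by exact/measurable_EFinP.
refine (etrans _ (integral_pushforward (measurable_shift v) mEf int_fv mA)).
apply: eq_measure_integral; first exact: measurable_shift.
move=> mphi B mB _; exact/esym/lebesgue_plane_shift.
Qed.

(** The integrals over [A] and [A'] are opposite, and the part over their intersection cancels from
    their difference. *)
Lemma Rintegral_antiperiodic (A : set plane) (f : plane -> R) (c : R) (v : R * R) :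
  measurable A -> (leb2 A < +oo)%E -> measurable_fun setT f ->
  (forall p, `|f p| <= c) -> (forall p, f (p + v) = - f p) ->
  let A' : set plane := (fun p => p + v) @^-1` A in
  2 * Rintegral leb2 A f =
    Rintegral leb2 (A `\` A') f - Rintegral leb2 (A' `\` A) f.
Proof.
have lin (x y z t u : R) : x = - y -> x = z + t -> y = z + u -> 2 * x = t - u.
  lra.
move=> mA Aoo mf fc fv A'.
have mA' : measurable A'.
  by rewrite -[X in measurable X]setTI; exact: measurable_shift.
have A'oo : (leb2 A' < +oo)%E by rewrite lebesgue_plane_shift.
have shift : Rintegral leb2 A f = - Rintegral leb2 A' f.
  rewrite (Rintegral_shift v mA Aoo mf fc) -[RHS]mulN1r.
  rewrite -RintegralZl//; last exact: (bounded_integrable mA' A'oo mf (fun p _ => fc p)).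
  by apply: eq_Rintegral => p _; rewrite fv mulN1r.
have split2 (X Y : set plane) : measurable X -> measurable Y -> (leb2 X < +oo)%E ->
    Rintegral leb2 X f = Rintegral leb2 (X `&` Y) f + Rintegral leb2 (X `\` Y) f.
  move=> mX mY Xoo; rewrite -Rintegral_setU ?setUIDK//.
  - exact: measurableI.
  - exact: measurableD.
  - exact: (bounded_integrable mX Xoo mf (fun p _ => fc p)).
  - by apply/disj_setPS => p [[_ Yp] [_ /(_ Yp)]].
have s1 := split2 A A' mA mA' Aoo; have s2 := split2 A' A mA' mA A'oo.
rewrite setIC in s2.
exact: lin shift s1 s2.
Qed.

Variable D : set (R * R).
Hypothesis hD : piecewise_smooth_domain D.

Lemma arrayP a p : 0 < a -> array a D p <-> D (p.1 / a, p.2 / a).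
Proof.
move=> a0; have au : a != 0 by rewrite gt_eqF.
have e1 (x : R) : a * x / a = x by rewrite mulrAC mulfV// mul1r.
have e2 (x : R) : a * (x / a) = x by rewrite mulrCA mulfV// mulr1.
split=> [[q Dq <-]/=|Dp]; first by rewrite !e1; case: q Dq.
by exists (p.1 / a, p.2 / a) => //=; rewrite !e2; case: p Dp.
Qed.

Lemma measurable_array a : 0 < a -> measurable (array a D : set plane).
Proof.
move=> a0; have [oD _ _ _ _] := hD.
rewrite (_ : array a D = (fun p => (p.1 / a, p.2 / a)) @^-1` D); last first.
  by apply/seteqP; split => p /= /arrayP; apply.
rewrite -[X in measurable X]setTI.
have mf : measurable_fun setT (fun p : plane => ((p.1 / a, p.2 / a) : plane)).
  apply: measurable_fun_pair.
  - by apply: measurable_funM; [exact: measurable_fst|exact: measurable_cst].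
  - by apply: measurable_funM; [exact: measurable_snd|exact: measurable_cst].
by apply: mf => //; exact: open_measurable_plane.
Qed.

Lemma array_bounded : exists2 M, 0 < M &
  forall a p, 0 < a -> array a D p -> `|p.1| <= M * a /\ `|p.2| <= M * a.
Proof.
have [_ _ _ [M hM] _] := hD.
exists (`|M| + 1); first by rewrite ltr_wpDl.
move=> a _ a0 [q Dq <-] /=.
have qM : enorm2 q <= `|M| + 1.
  by rewrite (le_trans (hM q Dq))// (le_trans (ler_norm M))// lerDl.
have [q1 q2] := enorm2_le q.
rewrite !normrM (gtr0_norm a0) [_ * a]mulrC !ler_pM2l//.
by split; [exact: le_trans q1 qM|exact: le_trans q2 qM].
Qed.

(** The array lies in a square of half-side [M * a], and contains the scaled copy of a square around
    an interior point of [D]. *)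
Lemma array_area : exists c C : R, [/\ 0 < c, 0 < C & forall a, 0 < a ->
  [/\ (leb2 (array a D) < +oo)%E, c * a ^+ 2 <= area (array a D) &
      area (array a D) <= C * a ^+ 2]].
Proof.
have [M M0 hM] := array_bounded.
have [oD _ [q Dq] _ _] := hD.
have /nbhs_ballP[e /= e0 qe] : nbhs q D by apply: open_nbhs_nbhs.
exists (e ^+ 2), (4 * M ^+ 2); split; rewrite ?mulr_gt0 ?exprn_gt0//.
move=> a a0; have mA := measurable_array a0.
have upper : (leb2 (array a D) <= (4 * M ^+ 2 * a ^+ 2)%:E)%E.
  rewrite -mulrA -exprMn -(@lebesgue_box R 0); last by rewrite mulr_ge0 ?ltW.
  apply: le_measure; rewrite ?inE; [exact: mA|exact: measurable_box|].
  move=> p /(hM _ _ a0)[p1 p2]; split => /=; rewrite in_itv /= ?add0r ?sub0r.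
  - by rewrite -ler_norml.
  - by rewrite -ler_norml.
have fin : (leb2 (array a D) < +oo)%E by apply: (le_lt_trans upper); exact: ltry.
have finE : (area (array a D))%:E = leb2 (array a D).
  by rewrite /area fineK// ge0_fin_numE.
split => //; last by rewrite -lee_fin finE.
rewrite -lee_fin finE.
(* Half of [e] is taken because the box is closed and must land in an open ball of radius [e] after
   division by [a]. *)
have -> : e ^+ 2 * a ^+ 2 = 4 * (a * (e / 2)) ^+ 2 by field.
rewrite -(@lebesgue_box R (a * q.1, a * q.2)); last by rewrite mulr_ge0 ?divr_ge0 ?ltW.
apply: le_measure; rewrite ?inE; [exact: measurable_box|exact: mA|].
move=> p [p1 p2]; apply/arrayP => //; apply: qe.
have H (x y : R) : x \in `[a * y - a * (e / 2), a * y + a * (e / 2)] -> ball y e (x / a).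
  rewrite in_itv /= => h; rewrite /ball /= distrC.
  have -> : x / a - y = (x - a * y) / a by field; rewrite gt_eqF.
  rewrite normrM normfV (gtr0_norm a0) ltr_pdivrMr//.
  apply: (@le_lt_trans _ _ (a * (e / 2))); first by rewrite ler_norml; lra.
  by rewrite mulrC ltr_pM2r//; lra.
by split; apply: H.
Qed.

Lemma measurable_cosine (w : R * R) (phi : R) :
  measurable_fun setT (fun p : plane => cos (w.1 * p.1 + w.2 * p.2 + phi)).
Proof.
apply: measurableT_comp.
  by apply: continuous_measurable_fun; exact: continuous_cos.
apply: measurable_funD; last exact: measurable_cst.
apply: measurable_funD; apply: measurable_funM; try exact: measurable_cst.
- exact: measurable_fst.
- exact: measurable_snd.
Qed.

(* Translating by [v = (pi / |w|^2) w] changes the sign of the integrand, so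
   that twice the integral is carried by the symmetric difference of the domain
   and its translate, which lies within [|v|] of the boundary. *)
Lemma oscillatory_integral_bound : exists2 C, 0 < C & forall a w phi, 0 < a -> w != 0 ->
  `|Rintegral leb2 (array a D) (fun p => cos (w.1 * p.1 + w.2 * p.2 + phi))|
    <= C * (a / enorm2 w).
Proof.
have [oD _ _ _ [n [g [rg bD]]]] := hD.
have [C C0 hC] := curves_nbhd_cover rg.
have [c' [C' [_ C'0 hC']]] := array_area.
exists ((C + C') * pi); first by apply: mulr_gt0; [exact: addr_gt0|exact: pi_gt0].
move=> a w phi a0 w0.
have half (x y z c : R) : 2 * x = y - z -> `|y| <= c -> `|z| <= c -> `|x| <= c.
  by rewrite !ler_norml; lra.
pose f (p : plane) : R := cos (w.1 * p.1 + w.2 * p.2 + phi).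
pose A : set plane := array a D.
rewrite -/(f) -/A.
have mf : measurable_fun setT f by exact: measurable_cosine.
have f1 p : `|f p| <= 1 by exact: cos_max.
have mA : measurable A by exact: measurable_array.
have [Aoo _ areaA] := hC' a a0.
have W0 := enorm2_gt0 w0.
have W2 : enorm2 w ^+ 2 = w.1 ^+ 2 + w.2 ^+ 2.
  by rewrite sqr_sqrtr// addr_ge0 ?sqr_ge0.
(* When the translation is longer than [a], the covering lemma does not apply since [d] would exceed
   1; there [a < pi / enorm2 w], so the area bound is enough. *)
have [small|large] := ltP (enorm2 w * a) pi.
  apply: (le_trans (le_normr_bounded_Rintegral mA Aoo mf (fun p _ => f1 p))).
  rewrite mul1r; apply: (le_trans areaA).
  rewrite mulrA ler_pdivlMr//.
  have -> : C' * a ^+ 2 * enorm2 w = C' * (enorm2 w * a) * a by ring.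
  rewrite ler_pM2r//; apply: (@le_trans _ _ (C' * pi)).
    by rewrite ler_pM2l// ltW.
  by rewrite ler_wpM2r ?pi_ge0// lerDr ltW.
pose W := enorm2 w.
(* Chosen so that [a * d = pi / W] is the Euclidean length of the translation [v]. *)
pose d := pi / (W * a).
have d01 : 0 < d <= 1.
  by rewrite divr_gt0 ?pi_gt0 ?mulr_gt0//= ler_pdivrMr ?mul1r// mulr_gt0.
have [U [mU Ule hU]] := hC a d a0 d01.
pose v : R * R := (pi / W ^+ 2 * w.1, pi / W ^+ 2 * w.2).
have Wu : W != 0 by rewrite gt_eqF.
have wv : w.1 * v.1 + w.2 * v.2 = pi.
  have -> : w.1 * v.1 + w.2 * v.2 = pi / W ^+ 2 * (w.1 ^+ 2 + w.2 ^+ 2).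
    by rewrite /v /=; ring.
  by rewrite -W2 -/W divfK// expf_neq0.
have fv p : f (p + v) = - f p.
  rewrite /f -cosDpi; congr cos; rewrite -wv /=; ring.
pose A' : set plane := (fun p => p + v) @^-1` A.
have mA' : measurable A'.
  by rewrite -[X in measurable X]setTI; exact: measurable_shift.
have A'oo : (leb2 A' < +oo)%E by rewrite lebesgue_plane_shift.
have v_le x : x = w.1 \/ x = w.2 -> `|pi / W ^+ 2 * x| <= a * d.
  move=> xw; have xW : `|x| <= W.
    by have [w1 w2] := enorm2_le w; case: xw => ->.
  rewrite normrM ger0_norm; last by rewrite divr_ge0 ?pi_ge0 ?sqr_ge0.
  have -> : a * d = pi / W ^+ 2 * W by rewrite /d; field; rewrite Wu gt_eqF.
  by rewrite ler_wpM2l// divr_ge0 ?pi_ge0 ?sqr_ge0.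
(* The segment joining the rescaled points meets the boundary of [D]. Scaled back, both its ends are
   within [a * d] of that point in each coordinate. Allowing both orientations of [v] covers both
   halves of the symmetric difference. *)
have crossing (p q : R * R) : A p -> ~ A q -> (q = p + v \/ p = q + v) ->
    U p /\ U q.
  move=> /(arrayP _ a0) Dp nAq pq.
  have nDq : ~ D (q.1 / a, q.2 / a) by move=> Dq; apply: nAq; apply/arrayP.
  have [s /andP[s0 s1]] := segment_crosses_boundary oD Dp nDq.
  rewrite bD => -[i [t [t01 e]]].
  have au : a != 0 by rewrite gt_eqF.
  have key (x y z : R) : z = x / a + s * (y / a - x / a) -> `|y - x| <= a * d ->
      `|x - a * z| <= a * d /\ `|y - a * z| <= a * d.
    move=> -> h.
    have -> : x - a * (x / a + s * (y / a - x / a)) = - (s * (y - x)) by field.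
    have -> : y - a * (x / a + s * (y / a - x / a)) = (1 - s) * (y - x) by field.
    have s1' : 0 <= 1 - s by lra.
    rewrite normrN !normrM (ger0_norm s0) (ger0_norm s1').
    split; apply: le_trans h; apply: ler_piMl => //; lra.
  have diff1 : `|q.1 - p.1| <= a * d.
    have := v_le w.1 (or_introl erefl).
    case: pq => -> /=; first by rewrite addrAC subrr add0r.
    by rewrite opprD addrA subrr add0r normrN.
  have diff2 : `|q.2 - p.2| <= a * d.
    have := v_le w.2 (or_intror erefl).
    case: pq => -> /=; first by rewrite addrAC subrr add0r.
    by rewrite opprD addrA subrr add0r normrN.
  have [x1 y1] := key p.1 q.1 (g i t).1 (esym (congr1 fst e)) diff1.
  have [x2 y2] := key p.2 q.2 (g i t).2 (esym (congr1 snd e)) diff2.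
  by split; [exact: (hU p i t)|exact: (hU q i t)].
have twice := Rintegral_antiperiodic mA Aoo mf f1 fv.
have piece (X : set plane) : measurable X -> X `<=` U ->
    `|Rintegral leb2 X f| <= C * a ^+ 2 * d.
  move=> mX XU.
  have Xle : (leb2 X <= (C * a ^+ 2 * d)%:E)%E.
    by apply: le_trans Ule; apply: le_measure; rewrite ?inE.
  have Xoo : (leb2 X < +oo)%E by apply: (le_lt_trans Xle); exact: ltry.
  apply: (le_trans (le_normr_bounded_Rintegral mX Xoo mf (fun p _ => f1 p))).
  by rewrite mul1r -lee_fin fineK// ge0_fin_numE.
have b1 : `|Rintegral leb2 (A `\` A') f| <= C * a ^+ 2 * d.
  apply: piece; first exact: measurableD.
  by move=> p [Ap nA'p]; have [] := crossing p (p + v) Ap nA'p (or_introl erefl).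
have b2 : `|Rintegral leb2 (A' `\` A) f| <= C * a ^+ 2 * d.
  apply: piece; first exact: measurableD.
  by move=> p [A'p nAp]; have [] := crossing (p + v) p A'p nAp (or_intror erefl).
have Cd : C * a ^+ 2 * d = C * pi * (a / W).
  by rewrite /d; field; rewrite Wu gt_eqF.
have : `|Rintegral leb2 A f| <= C * a ^+ 2 * d.
  exact: half twice b1 b2.
rewrite Cd => h; apply: (le_trans h); rewrite ler_wpM2r ?divr_ge0 ?ltW//.
by rewrite mulrDl ltrDl mulr_gt0 ?pi_gt0.
Qed.

End OscillatoryIntegral.

(** * Norms of complex matrices *)

Section ComplexModulus.
Context {R : realType}.
Local Open Scope complex_scope.
Local Notation normc := (@Normc.normc R).
Implicit Types z t : R[i].

Lemma normc_ge0 z : 0 <= normc z.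
Proof. by case: z => x y; exact: sqrtr_ge0. Qed.

Lemma normc0 : normc 0 = 0.
Proof. exact: Normc.normc0. Qed.

Lemma normc1 : normc 1 = 1.
Proof. exact: Normc.normc1. Qed.

Lemma normcM z t : normc (z * t) = normc z * normc t.
Proof. exact: Normc.normcM. Qed.

Lemma normcD z t : normc (z + t) <= normc z + normc t.
Proof. exact: le_normcD. Qed.

Lemma normcB z t : normc (z - t) <= normc z + normc t.
Proof. by rewrite -[normc t]normcN; exact: normcD. Qed.

Lemma normc_real (x : R) : normc x%:C = `|x|.
Proof. by rewrite /= expr0n addr0 sqrtr_sqr. Qed.

Lemma normc_i : normc 'i = 1.
Proof. by rewrite /= expr0n add0r expr1n sqrtr1. Qed.

Lemma normc_conj z : normc (conjc z) = normc z.
Proof. by case: z => x y /=; rewrite sqrrN. Qed.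

Lemma normc_Re z : `|complex.Re z| <= normc z.
Proof. by case: z => x y /=; rewrite -sqrtr_sqr ler_wsqrtr// lerDl sqr_ge0. Qed.

Lemma normc_Im z : `|complex.Im z| <= normc z.
Proof. by case: z => x y /=; rewrite -sqrtr_sqr ler_wsqrtr// lerDr sqr_ge0. Qed.

Lemma normc_le z : normc z <= `|complex.Re z| + `|complex.Im z|.
Proof.
case: z => x y /=; rewrite -[leRHS]ger0_norm ?addr_ge0// -sqrtr_sqr ler_wsqrtr//.
by rewrite sqrrD !real_normK ?num_real// lerD2r lerDl mulrn_wge0// mulr_ge0.
Qed.

Lemma normc_sum (I : Type) (s : seq I) (F : I -> R[i]) :
  normc (\sum_(i <- s) F i) <= \sum_(i <- s) normc (F i).
Proof.
elim/big_ind2: _ => //; first by rewrite normc0.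
by move=> z1 z2 x1 x2 h1 h2; apply: (le_trans (normcD _ _)); exact: lerD.
Qed.

Lemma normc_cis (x : R) : normc (cis x) = 1.
Proof. by rewrite /= cos2Dsin2 sqrtr1. Qed.

Lemma cisD (x y : R) : cis (x + y) = cis x * cis y.
Proof. by rewrite /cis cosD sinD; simpc; congr (_ +i* _); rewrite addrC. Qed.

Lemma conjc_cis (x : R) : conjc (cis x) = cis (- x).
Proof. by rewrite /cis /= cosN sinN. Qed.

Lemma cis0 : cis (0 : R) = 1.
Proof. by rewrite /cis cos0 sin0. Qed.

(** Cosine is 1-Lipschitz by the mean value theorem, and sine is a shifted cosine; the factor 2
    comes from adding real and imaginary parts. *)
Lemma normc_cisB (x y : R) : normc (cis x - cis y) <= 2 * `|x - y|.
Proof.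
have main u v : u <= v -> `|cos v - cos u| <= `|v - u| :> R.
  move=> uv; have [c _ ->] : exists2 c, c \in `[u, v] & cos v - cos u = - sin c * (v - u).
    by apply: MVT_segment => //; apply: continuous_subspaceT; exact: continuous_cos.
  by rewrite normrM normrN ler_piMl// sin_max.
have cosB u v : `|cos u - cos v| <= `|u - v| :> R.
  have [uv|/ltW vu] := leP u v; last exact: main.
  by rewrite distrC (distrC u); exact: main.
apply: (le_trans (normc_le _)) => /=.
rewrite mulrDl mul1r; apply: lerD => //.
rewrite -!cosBpihalf; apply: (le_trans (cosB _ _)).
by rewrite opprB addrA subrK.
Qed.

End ComplexModulus.

(** * The entrywise norm and equivalence of norms *)

Section EntrywiseNorm.
Context {R : realType}.
Local Open Scope complex_scope.
Local Notation normc := (@Normc.normc R).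
Local Notation mat := 'M[R[i]]_3.
Implicit Types A B : mat.

Definition mxnorm1 A : R := \sum_i \sum_j normc (A i j).

Lemma mxnorm1_ge0 A : 0 <= mxnorm1 A.
Proof. by apply: sumr_ge0 => i _; apply: sumr_ge0 => j _; exact: normc_ge0. Qed.

Lemma mxnorm1D A B : mxnorm1 (A + B) <= mxnorm1 A + mxnorm1 B.
Proof.
rewrite /mxnorm1 -big_split; apply: ler_sum => i _.
by rewrite -big_split; apply: ler_sum => j _; rewrite mxE; exact: normcD.
Qed.

Lemma mxnorm1Z c A : mxnorm1 (c *: A) = normc c * mxnorm1 A.
Proof.
rewrite /mxnorm1 mulr_sumr; apply: eq_bigr => i _.
by rewrite mulr_sumr; apply: eq_bigr => j _; rewrite mxE normcM.
Qed.

Lemma mxnorm10 : mxnorm1 0 = 0.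
Proof. by rewrite -(scale0r 0) mxnorm1Z normc0 mul0r. Qed.

Lemma mxnorm1N A : mxnorm1 (- A) = mxnorm1 A.
Proof. by apply: eq_bigr => i _; apply: eq_bigr => j _; rewrite mxE normcN. Qed.

Lemma mxnorm1M A B : mxnorm1 (A *m B) <= mxnorm1 A * mxnorm1 B.
Proof.
rewrite /mxnorm1 mulr_suml; apply: ler_sum => i _.
apply: (@le_trans _ _ (\sum_j \sum_k normc (A i k) * normc (B k j))).
  apply: ler_sum => j _; rewrite mxE; apply: (le_trans (normc_sum _ _)).
  by apply: ler_sum => k _; rewrite normcM.
rewrite exchange_big mulr_suml; apply: ler_sum => k _ /=.
rewrite -mulr_sumr ler_wpM2l ?normc_ge0//.
rewrite [leRHS](bigD1 k)//= lerDl; apply: sumr_ge0 => l _.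
by apply: sumr_ge0 => j _; exact: normc_ge0.
Qed.

Lemma mxnorm1_conj A : mxnorm1 (Defs.conjmx A) = mxnorm1 A.
Proof. by apply: eq_bigr => i _; apply: eq_bigr => j _; rewrite mxE normc_conj. Qed.

Lemma mxnorm1_entry A i j : normc (A i j) <= mxnorm1 A.
Proof.
rewrite /mxnorm1 (bigD1 i)//= (bigD1 j)//= -addrA lerDl.
apply: addr_ge0; first by apply: sumr_ge0 => l _; exact: normc_ge0.
by apply: sumr_ge0 => l _; apply: sumr_ge0 => m _; exact: normc_ge0.
Qed.

Lemma mxnorm1_le A c : (forall i j, normc (A i j) <= c) -> mxnorm1 A <= 9 * c.
Proof.
move=> h; rewrite /mxnorm1 !big_ord_recl !big_ord0.
have h00 := h ord0 ord0; have h01 := h ord0 (lift ord0 ord0).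
have h02 := h ord0 (lift ord0 (lift ord0 ord0)).
have h10 := h (lift ord0 ord0) ord0; have h11 := h (lift ord0 ord0) (lift ord0 ord0).
have h12 := h (lift ord0 ord0) (lift ord0 (lift ord0 ord0)).
have h20 := h (lift ord0 (lift ord0 ord0)) ord0.
have h21 := h (lift ord0 (lift ord0 ord0)) (lift ord0 ord0).
have h22 := h (lift ord0 (lift ord0 ord0)) (lift ord0 (lift ord0 ord0)).
lra.
Qed.

Variable N : mat -> R.
Hypothesis hN : matrix_norm N.

Lemma matrix_norm0 : N 0 = 0.
Proof. by have [_ NZ _] := hN; rewrite -(scale0r 0) NZ normc0 mul0r. Qed.

Lemma matrix_normN A : N (- A) = N A.
Proof. by have [_ NZ _] := hN; rewrite -scaleN1r NZ normcN normc1 mul1r. Qed.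

Lemma matrix_norm_ge0 A : 0 <= N A.
Proof.
have [_ _ ND] := hN; have := ND A (- A).
by rewrite subrr matrix_norm0 matrix_normN -mulr2n pmulrn_lge0.
Qed.

(** Expansion in the elementary matrices; the extra 1 in [C] makes its positivity immediate. *)
Lemma matrix_norm_le_mxnorm1 : exists2 C, 0 < C & forall A, N A <= C * mxnorm1 A.
Proof.
have [_ NZ ND] := hN.
have Nsum (I : Type) (s : seq I) (F : I -> mat) :
    N (\sum_(i <- s) F i) <= \sum_(i <- s) N (F i).
  elim/big_ind2: _ => //; first by rewrite matrix_norm0.
  by move=> A1 A2 x1 x2 h1 h2; apply: (le_trans (ND _ _)); exact: lerD.
pose C := 1 + \sum_i \sum_j N (delta_mx i j).
have sum_ge0 : 0 <= \sum_i \sum_j N (delta_mx i j : mat).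
  by apply: sumr_ge0 => i _; apply: sumr_ge0 => j _; exact: matrix_norm_ge0.
exists C; first by rewrite ltr_pwDl.
move=> A; rewrite [X in N X]matrix_sum_delta.
apply: (le_trans (Nsum _ _ _)); rewrite /mxnorm1 mulr_sumr.
apply: ler_sum => i _; apply: (le_trans (Nsum _ _ _)); rewrite mulr_sumr.
apply: ler_sum => j _; rewrite NZ mulrC ler_wpM2r ?normc_ge0//.
apply: (@le_trans _ _ (\sum_i \sum_j N (delta_mx i j : mat))); last by rewrite lerDr.
rewrite (bigD1 i)//= (bigD1 j)//= -addrA lerDl.
apply: addr_ge0; first by apply: sumr_ge0 => l _; exact: matrix_norm_ge0.
by apply: sumr_ge0 => l _; apply: sumr_ge0 => m _; exact: matrix_norm_ge0.
Qed.

(* The l^1 sphere of R^18 = C^9 is compact, so that [N] has a positive minimum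
   there. *)
Lemma mxnorm1_le_matrix_norm : exists2 C, 0 < C & forall A, mxnorm1 A <= C * N A.
Proof.
have [Nsep NZ ND] := hN.
have [C C0 hC] := matrix_norm_le_mxnorm1.
(* Real coordinates on complex matrices: nine real parts followed by nine imaginary parts. [psi] is
   a right inverse of [phi]. *)
pose phi (u : 'rV[R]_(3 * 3 + 3 * 3)) : mat :=
  \matrix_(i, j) (vec_mx (lsubmx u) i j +i* vec_mx (rsubmx u) i j).
pose psi (A : mat) : 'rV[R]_(3 * 3 + 3 * 3) :=
  row_mx (mxvec (map_mx (@complex.Re R) A)) (mxvec (map_mx (@complex.Im R) A)).
have psiK A : phi (psi A) = A.
  apply/matrixP => i j; rewrite /phi /psi mxE row_mxKl row_mxKr !mxvecK !mxE.
  by case: (A i j).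
have phiB u v : phi (u - v) = phi u - phi v.
  by apply/matrixP => i j; rewrite !mxE.
have entry_le (u : 'rV[R]_(3 * 3 + 3 * 3)) k : `|u 0 k| <= `|u|.
  rewrite [leRHS]/Num.norm /= mx_normrE; apply/bigmax_geP; right.
  by exists (0, k).
have phi_le u : mxnorm1 (phi u) <= 18 * `|u|.
  have -> : 18 * `|u| = 9 * (2 * `|u|) by ring.
  apply: mxnorm1_le => i j; apply: (le_trans (normc_le _)); rewrite !mxE /=.
  by rewrite mulrDl mul1r; apply: lerD; exact: entry_le.
pose S : set 'rV[R]_(3 * 3 + 3 * 3) := [set u | mxnorm1 (phi u) = 1].
(* An even subadditive function dominated by [mxnorm1] is Lipschitz. This is applied to [mxnorm1],
   making the sphere closed, and to [N], which is to be minimized. *)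
have lip (g : mat -> R) (K : R) : (forall A B, g (A + B) <= g A + g B) ->
    (forall A, g (- A) = g A) -> 0 < K -> (forall A, g A <= K * mxnorm1 A) ->
    continuous (fun u => g (phi u)).
  move=> gD gN K0 gK u; apply/(cvgrPdist_lt (FF := nbhs_filter u)) => e e0.
  near=> v.
  have tri A B : `|g A - g B| <= g (A - B).
    have h1 := gD (A - B) B; have h2 := gD (B - A) A.
    have h3 : g (B - A) = g (A - B) by rewrite -opprB gN.
    by rewrite subrK in h1; rewrite subrK h3 in h2; rewrite ler_norml; lra.
  apply: (le_lt_trans (tri _ _)); rewrite -phiB; apply: (le_lt_trans (gK _)).
  rewrite mulrC -ltr_pdivlMr//; apply: (le_lt_trans (phi_le _)).
  rewrite mulrC -ltr_pdivlMr//.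
  near: v; apply/nbhs_ballP; exists (e / K / 18); first by rewrite /= !divr_gt0.
  by move=> v; rewrite -ball_normE.
have Scompact : compact S.
  apply: bounded_closed_compact.
    exists 1; split; first exact: num_real.
    move=> M M1 u Su /=; rewrite [leLHS]/Num.norm /= mx_normrE.
    apply/bigmax_leP; split => /=; first by rewrite (le_trans _ (ltW M1)).
    case=> i k _ /=; rewrite (ord1 i); apply: le_trans (ltW M1); rewrite -Su.
    have -> : u 0 k = row_mx (lsubmx u) (rsubmx u) 0 k by rewrite hsubmxK.
    rewrite mxE; case: (fintype.split k) => l; case/mxvec_indexP: l => i' j';
      apply: (le_trans _ (mxnorm1_entry (phi u) i' j')).
    - by apply: le_trans (normc_Re _); rewrite !mxE.
    - by apply: le_trans (normc_Im _); rewrite !mxE.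
  rewrite (_ : S = (fun u => mxnorm1 (phi u)) @^-1` [set 1]) //.
  apply: preimage_closed; last exact: closed_eq.
  move=> u _; apply: (lip _ 1) => //.
  - exact: mxnorm1D.
  - exact: mxnorm1N.
  - by move=> A; rewrite mul1r.
have S0 : S !=set0.
  exists (psi ((9^-1)%:C *: const_mx 1)); rewrite /S /= psiK mxnorm1Z normc_real.
  rewrite /mxnorm1; under eq_bigr do under eq_bigr do rewrite mxE normc1.
  rewrite !sumr_const card_ord -mulrnA ger0_norm ?invr_ge0//.
  by rewrite mulVf// pnatr_eq0.
have [u Su umin] : exists2 u, u \in S & forall v, v \in S -> N (phi u) <= N (phi v).
  apply: EVT_min_rV => //.
  apply: continuous_subspaceT.
  by apply: (lip N C) => //; exact: matrix_normN.
have Nu : 0 < N (phi u).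
  rewrite lt_neqAle matrix_norm_ge0 andbT eq_sym; apply/eqP => /Nsep phiu0.
  by move: Su; rewrite inE /S /= phiu0 mxnorm10 => /esym/eqP; rewrite oner_eq0.
exists (N (phi u))^-1; first by rewrite invr_gt0.
move=> A; have [A0|A0] := eqVneq (mxnorm1 A) 0.
  by rewrite A0 mulr_ge0 ?invr_ge0 ?matrix_norm_ge0// ltW.
have Apos : 0 < mxnorm1 A by rewrite lt_neqAle eq_sym A0 mxnorm1_ge0.
have := umin (psi ((mxnorm1 A)^-1%:C *: A)).
rewrite psiK NZ normc_real (ger0_norm (ltW _)) ?invr_gt0// => h.
rewrite -[leRHS]mulrC ler_pdivlMr// mulrC -ler_pdivlMr// mulrC.
apply: h; rewrite inE /S /= psiK mxnorm1Z normc_real ger0_norm ?invr_ge0 ?ltW//.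
by rewrite mulVf.
Unshelve. all: by end_near. Qed.

End EntrywiseNorm.

(** * Projections and the amplitude of the Green function *)

Section Projections.
Context {R : realType}.
Local Open Scope complex_scope.
Local Notation normc := (@Normc.normc R).
Local Notation vec := 'rV[R]_3.
Local Notation mat := 'M[R[i]]_3.
Implicit Types v : vec.

Lemma enorm3_sqr v : enorm3 v ^+ 2 = \sum_i v 0 i ^+ 2.
Proof. by rewrite sqr_sqrtr// sumr_ge0// => i _; exact: sqr_ge0. Qed.

Lemma enorm3_ge0 v : 0 <= enorm3 v.
Proof. exact: sqrtr_ge0. Qed.

Lemma enorm3N v : enorm3 (- v) = enorm3 v.
Proof. by congr Num.sqrt; apply: eq_bigr => i _; rewrite mxE sqrrN. Qed.

Lemma enorm3_entry v i : `|v 0 i| <= enorm3 v.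
Proof.
rewrite -sqrtr_sqr ler_wsqrtr// (bigD1 i)//= lerDl.
by apply: sumr_ge0 => j _; exact: sqr_ge0.
Qed.

Lemma enorm3_point3 (p : R * R) (z : R) :
  enorm3 (point3 p z) ^+ 2 = p.1 ^+ 2 + p.2 ^+ 2 + z ^+ 2.
Proof. by rewrite enorm3_sqr !big_ord_recl big_ord0 !mxE /= addr0 addrA. Qed.

Lemma realcV (x : R) : (x^-1)%:C = (x%:C)^-1 :> R[i].
Proof. exact: fmorphV. Qed.

Definition dyad v : mat := map_mx (real_complex R) (v^T *m v).

Lemma dyadE v i j : dyad v i j = (v 0 i * v 0 j)%:C.
Proof. by rewrite !mxE big_ord1 !mxE. Qed.

(** The bracket of the Green function at m = 0. For nonzero [v] it is the orthogonal projector onto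
    the complement of [v]; for [v = 0] it is the identity. *)
Definition perpmx v : mat := 1%:M - ((enorm3 v ^+ 2)^-1)%:C *: dyad v.

Lemma perpmxE v i j :
  perpmx v i j = ((i == j)%:R - v 0 i * v 0 j / enorm3 v ^+ 2)%:C.
Proof.
by rewrite !mxE big_ord1 !mxE rmorphB rmorph_nat mulrC -rmorphM.
Qed.

Lemma perpmxN v : perpmx (- v) = perpmx v.
Proof.
have e : (- v)^T = - v^T by apply/matrixP => i j; rewrite !mxE.
by rewrite /perpmx /dyad enorm3N e mulNmx mulmxN opprK.
Qed.

Lemma perpmx_conj v : Defs.conjmx (perpmx v) = perpmx v.
Proof. by apply/matrixP => i j; rewrite mxE perpmxE /= oppr0. Qed.

Lemma mxnorm1_perpmx v : mxnorm1 (perpmx v) <= 18.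
Proof.
rewrite (_ : 18 = 9 * 2); last by ring.
apply: mxnorm1_le => i j; rewrite perpmxE normc_real.
apply: (le_trans (ler_normB _ _)); rewrite -[2]/(1 + 1); apply: lerD.
  by case: (i == j); rewrite ?normr1 ?normr0.
have [v0|v0] := eqVneq (enorm3 v) 0.
  by rewrite v0 expr0n invr0 mulr0 normr0.
rewrite normrM normfV normrX !normrM (ger0_norm (enorm3_ge0 v)).
rewrite ler_pdivrMr ?mul1r; last by rewrite exprn_gt0// lt_neqAle eq_sym v0 enorm3_ge0.
by rewrite expr2; apply: ler_pM => //; exact: enorm3_entry.
Qed.

Local Notation "B ^!" :=
  (orthomx Num.conj (mx_of_hermitian (hermitian1mx _)) B) : matrix_set_scope.

(** Write the identity as [(1 - P) + P]: the projection kills the rows of the first term and fixes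
    those of the second. *)
Lemma proj_ortho_unique m n (U : 'M[R[i]]_(m, n)) (P : 'M[R[i]]_n) :
  (P <= U)%MS -> (1%:M - P <= U^!)%MS -> proj_ortho U = P.
Proof.
move=> PU PUo; rewrite -[LHS]mul1mx -[1%:M](subrK P) mulmxDl.
by rewrite proj_ortho_0// proj_ortho_id// add0r.
Qed.

Lemma conj_real_mx m n (A : 'M[R]_(m, n)) :
  map_mx Num.conj (map_mx (real_complex R) A) = map_mx (real_complex R) A.
Proof.
apply/matrixP => i j; rewrite !mxE; apply/CrealP.
by apply/complex_realP; exists (A i j).
Qed.

(** The complement of the complement of [v] is the line of [v], which contains the rows of v v^T.
    Conjugation in the Hermitian form has no effect because [v] is real. *)
Lemma PperpE v : enorm3 v != 0 -> Pperp v = perpmx v.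
Proof.
move=> v0; pose V := map_mx (real_complex R) v.
have VV : V *m V^T = (enorm3 v ^+ 2)%:C%:M.
  rewrite /V map_trmx -map_mxM /=.
  apply/matrixP => i j; rewrite !ord1 !mxE eqxx mulr1n; congr _%:C.
  by rewrite enorm3_sqr; apply: eq_bigr => k _; rewrite mxE expr2.
have dyadV : dyad v = V^T *m V by rewrite /dyad map_mxM -map_trmx.
have v2 : (enorm3 v ^+ 2)%:C != 0 by rewrite fmorph_eq0 expf_neq0.
apply: proj_ortho_unique.
  apply/orthomx1P; rewrite -map_trmx conj_real_mx -/V.
  rewrite /perpmx mulmxBl mul1mx -scalemxAl dyadV -mulmxA VV mul_mx_scalar.
  by rewrite scalerA fmorphV mulVf// scale1r subrr.
rewrite /perpmx opprB addrC subrK ortho_id dyadV.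
by rewrite scalemx_sub// submxMl.
Qed.

(** The horizontal plane is the complement of the third axis, and any nonzero point of that axis
    serves. Thus both limit projectors become instances of [perpmx]. *)
Lemma PparE (L : R) : L != 0 -> Ppar = perpmx (point3 (0, 0) L).
Proof.
move=> L0; have v0 : enorm3 (point3 (0, 0) L) ^+ 2 = L ^+ 2.
  by rewrite enorm3_point3 /= expr0n !add0r.
pose U : 'M[R[i]]_(2, 3) := \matrix_(i < 2, j < 3) (i == j :> nat)%:R.
pose X : 'M[R[i]]_(3, 2) := \matrix_(i < 3, j < 2) (i == j :> nat)%:R.
have L2 : L * L / L ^+ 2 = 1 by rewrite -expr2 mulfV// expf_neq0.
have perpXU : perpmx (point3 (0, 0) L) = X *m U.
  apply/matrixP => i j; rewrite perpmxE v0 !mxE !big_ord_recl big_ord0 !mxE addr0.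
  case: i => [[|[|[|i]]] hi] //; case: j => [[|[|[|j]]] hj] //=;
    by rewrite ?(mul0r, mulr0, L2, mul1r, add0r, addr0) ?subrr ?subr0 ?oppr0.
apply: proj_ortho_unique; first by rewrite perpXU submxMl.
apply/orthomx1P; rewrite -/U perpXU.
have -> : map_mx Num.conj U^T = X.
  by apply/matrixP => i j; rewrite !mxE rmorph_nat eq_sym.
rewrite mulmxBl mul1mx -mulmxA (_ : U *m X = 1%:M) ?mulmx1 ?subrr//.
apply/matrixP => i j; rewrite !mxE !big_ord_recl big_ord0 !mxE.
case: i => [[|[|i]] hi] //; case: j => [[|[|j]] hj] //=;
  by rewrite ?(mul0r, mulr0, mul1r, add0r, addr0).
Qed.

End Projections.

(** * Far-field approximation of a single Green function *)

Section GreenAmplitude.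
Context {R : realType}.
Local Open Scope complex_scope.
Local Notation normc := (@Normc.normc R).
Local Notation vec := 'rV[R]_3.
Local Notation mat := 'M[R[i]]_3.
Implicit Types v : vec.

(** The Green function without its phase and without 1/(4 pi); [L] times it is what approaches a
    [perpmx]. *)
Definition amplitude (k : R) v : mat :=
  let r := enorm3 v in
  (r^-1)%:C *: ((1 + mcoef (k * r))%:M
    - ((1 + 3 * mcoef (k * r)) / (r ^+ 2)%:C) *: dyad v).

Lemma GreenE (x y : vec) (k : R) :
  Green x y k =
    (cis (k * enorm3 (x - y)) * ((4 * pi)^-1)%:C) *: amplitude k (x - y).
Proof.
rewrite /Green /amplitude scalerA; congr (_ *: _).
by rewrite -[RHS]mulrA; congr (_ * _); rewrite -realcV invfM; exact: (rmorphM (real_complex R)).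
Qed.

Lemma normc_mcoef (z : R) : 0 < z -> normc (mcoef z) <= z^-1 + z^-1 ^+ 2.
Proof.
move=> z0; rewrite /mcoef normcM -realcV normc_real.
have zu : z != 0 by rewrite gt_eqF.
have h : normc ('i * z%:C - 1) <= z + 1.
  apply: (le_trans (normcB _ _)).
  by rewrite normcM normc_i normc_real mul1r (gtr0_norm z0) normc1.
rewrite ger0_norm ?invr_ge0 ?sqr_ge0//.
apply: (le_trans (ler_wpM2r _ h)); first by rewrite invr_ge0 sqr_ge0.
by rewrite (_ : (z + 1) / z ^+ 2 = z^-1 + z^-1 ^+ 2)//; field.
Qed.

Lemma amplitudeE (k : R) v i j :
  let r := enorm3 v in
  amplitude k v i j = (r^-1)%:C * ((1 + mcoef (k * r)) * (i == j)%:R -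
    (1 + 3 * mcoef (k * r)) * (r ^+ 2)^-1%:C * (v 0 i * v 0 j)%:C).
Proof.
rewrite /amplitude /= mxE; congr (_ * _); rewrite mxE; congr (_ + _).
  by rewrite mxE mulr_natr.
by rewrite mxE; congr (- _); rewrite mxE dyadE realcV.
Qed.

(** Algebra that isolates the three small quantities: [L / r - 1] for the distance, [p - p0] for the
    direction, [mcoef] for the near field. *)
Lemma amplitude_entry (k L : R) v (v0 : vec) i j : enorm3 v != 0 ->
  let r := enorm3 v in
  let d : R := (i == j)%:R in
  let p := v 0 i * v 0 j / r ^+ 2 in
  let p0 := v0 0 i * v0 0 j / enorm3 v0 ^+ 2 in
  (L%:C *: amplitude k v - perpmx v0) i j =
    (d * (L / r - 1) - ((L / r - 1) * p + (p - p0)))%:C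
    + mcoef (k * r) * (L / r * (d - 3 * p))%:C.
Proof.
move=> r0 /=; rewrite mxE [in X in _ + X]mxE perpmxE mxE amplitudeE.
set r := enorm3 v; set m := mcoef _.
have -> : (i == j)%:R = ((i == j)%:R : R)%:C by rewrite rmorph_nat.
set d : R := (i == j)%:R.
ring.
Qed.

(* [684] is nine times the entrywise constant [14 + 14 + 16 + 32], whose terms come
   from the distance (twice), the direction and the near field. *)
Lemma amplitude_approx (k L e : R) v (v0 : vec) :
  0 < k -> 0 < L -> enorm3 v0 = L -> e <= 14^-1 -> 1 / (k * L) <= e ->
  (forall i, `|v 0 i - v0 0 i| <= e * L) ->
  mxnorm1 (L%:C *: amplitude k v - perpmx v0) <= 684 * e.
Proof.
move=> k0 L0 v0L e14 kLe close.
have kL0 : 0 < k * L by rewrite mulr_gt0.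
have e0 : 0 < e by rewrite (lt_le_trans _ kLe)// divr_gt0.
set r := enorm3 v.
have r_ge0 : 0 <= r by exact: enorm3_ge0.
have v0_le i : `|v0 0 i| <= L by rewrite -v0L; exact: enorm3_entry.
have sq_le i : `|v 0 i ^+ 2 - v0 0 i ^+ 2| <= e * (2 + e) * L ^+ 2.
  have -> : v 0 i ^+ 2 - v0 0 i ^+ 2 =
      (v 0 i - v0 0 i) * ((v 0 i - v0 0 i) + 2 * v0 0 i) by ring.
  have -> : e * (2 + e) * L ^+ 2 = (e * L) * (e * L + 2 * L) by ring.
  rewrite normrM; apply: ler_pM => //.
  apply: (le_trans (ler_normD _ _)); apply: lerD => //.
  by rewrite normrM ger0_norm// ler_pM2l.
have r2 : `|r ^+ 2 - L ^+ 2| <= 3 * (e * (2 + e) * L ^+ 2).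
  have -> : r ^+ 2 - L ^+ 2 = \sum_i (v 0 i ^+ 2 - v0 0 i ^+ 2).
    by rewrite -v0L !enorm3_sqr sumrB.
  apply: (le_trans (ler_norm_sum _ _ _)).
  apply: (le_trans (ler_sum _ (fun i _ => sq_le i))).
  by rewrite sumr_const card_ord -[leLHS]mulr_natl.
(* Divide the difference of squares by [r + L >= L], and use [3 * (2 + e) <= 7]. *)
have rL : `|r - L| <= 7 * e * L.
  have rL0 : 0 < r + L by rewrite ltr_wpDl.
  rewrite -(ler_pM2r rL0) -[X in _ * X <= _](gtr0_norm rL0) -normrM -subr_sqr.
  apply: (le_trans r2).
  have -> : 3 * (e * (2 + e) * L ^+ 2) = (3 * e * (2 + e) * L) * L by ring.
  apply: ler_pM; [|exact: ltW| |by rewrite lerDr].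
  - by rewrite !mulr_ge0 ?addr_ge0 ?ltW.
  - rewrite ler_pM2r//; nra.
(* The threshold [14^-1] is what makes [7 * e] at most 1/2. *)
have r_half : L / 2 <= r.
  have : `|r - L| <= L / 2.
    have : e * L <= 14^-1 * L by rewrite ler_pM2r.
    move: rL; lra.
  by rewrite ler_norml; lra.
have r0 : 0 < r by rewrite (lt_le_trans _ r_half)// divr_gt0.
have ru : r != 0 by rewrite gt_eqF.
have Lu : L != 0 by rewrite gt_eqF.
have tau2 : `|L / r| <= 2.
  by rewrite normrM normfV (gtr0_norm L0) (gtr0_norm r0) ler_pdivrMr//; lra.
have tau1 : `|L / r - 1| <= 14 * e.
  have -> : L / r - 1 = (L / r) * ((L - r) / L) by field; rewrite ru Lu.
  rewrite normrM (_ : 14 * e = 2 * (7 * e)); last by ring.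
  apply: ler_pM => //; rewrite normrM normfV (gtr0_norm L0) ler_pdivrMr//.
  by rewrite distrC.
have m_le : normc (mcoef (k * r)) <= 4 * e.
  apply: (le_trans (normc_mcoef _)); first by rewrite mulr_gt0.
  have kr : (k * r)^-1 <= 2 * e.
    apply: (@le_trans _ _ (2 * (1 / (k * L)))); last by rewrite ler_pM2l.
    rewrite mul1r -[2]invrK -invfM lef_pV2 ?posrE ?mulr_gt0//.
    by rewrite mulrCA ler_pM2l// mulrC.
  have kr0 : 0 <= (k * r)^-1 by rewrite invr_ge0 mulr_ge0 ?ltW.
  have : (k * r)^-1 ^+ 2 <= (2 * e) ^+ 2 by rewrite !expr2; apply: ler_pM.
  have : e * e <= 14^-1 * e by rewrite ler_pM2r.
  lra.
have u_le i : `|v 0 i / r| <= 1.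
  rewrite normrM normfV (gtr0_norm r0) ler_pdivrMr// mul1r.
  exact: enorm3_entry.
have u0_le i : `|v0 0 i / L| <= 1.
  by rewrite normrM normfV (gtr0_norm L0) ler_pdivrMr// mul1r.
have u_close i : `|v 0 i / r - v0 0 i / L| <= 8 * e.
  have -> : v 0 i / r - v0 0 i / L =
      (v 0 i / r) * ((L - r) / L) + (v 0 i - v0 0 i) / L by field; rewrite ru Lu.
  apply: (le_trans (ler_normD _ _)); rewrite (_ : 8 * e = 1 * (7 * e) + e); last by ring.
  apply: lerD.
    rewrite normrM; apply: ler_pM => //.
    by rewrite normrM normfV (gtr0_norm L0) ler_pdivrMr// distrC.
  by rewrite normrM normfV (gtr0_norm L0) ler_pdivrMr.
rewrite (_ : 684 * e = 9 * (76 * e)); last by ring.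
apply: mxnorm1_le => i j; rewrite amplitude_entry// -/r v0L.
set d : R := (i == j)%:R.
have d1 : `|d| <= 1 by rewrite /d; case: (i == j); rewrite ?normr1 ?normr0.
set p := v 0 i * v 0 j / r ^+ 2; set p0 := v0 0 i * v0 0 j / L ^+ 2.
have pE : p = (v 0 i / r) * (v 0 j / r) by rewrite /p; field.
have p0E : p0 = (v0 0 i / L) * (v0 0 j / L) by rewrite /p0; field.
have p1 : `|p| <= 1 by rewrite pE normrM -[1]mul1r; apply: ler_pM.
have pp0 : `|p - p0| <= 16 * e.
  have -> : p - p0 = (v 0 i / r) * (v 0 j / r - v0 0 j / L)
      + (v 0 i / r - v0 0 i / L) * (v0 0 j / L) by rewrite pE p0E; ring.
  apply: (le_trans (ler_normD _ _)).
  rewrite (_ : 16 * e = 1 * (8 * e) + (8 * e) * 1); last by ring.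
  by apply: lerD; rewrite normrM; apply: ler_pM.
apply: (le_trans (normcD _ _)); rewrite normcM !normc_real.
have -> : 76 * e = (1 * (14 * e) + ((14 * e) * 1 + 16 * e)) + (4 * e) * (2 * 4) by ring.
apply: lerD.
  apply: (le_trans (ler_normB _ _)); apply: lerD.
    by rewrite normrM; apply: ler_pM.
  apply: (le_trans (ler_normD _ _)); apply: lerD => //.
  by rewrite normrM; apply: ler_pM.
apply: ler_pM => //; rewrite ?normc_ge0// normrM; apply: ler_pM => //.
apply: (le_trans (ler_normB _ _)).
rewrite (_ : 4 = 1 + 3 * 1); last by ring.
apply: lerD => //; rewrite normrM (ger0_norm (ler0n R 3)) ler_pM2l//.
Qed.

Lemma mxnorm1_mul_approx (A B A0 B0 : mat) (a b x y : R) :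
  mxnorm1 (A - A0) <= x -> mxnorm1 (B - B0) <= y ->
  mxnorm1 A0 <= a -> mxnorm1 B0 <= b ->
  mxnorm1 (A *m B - A0 *m B0) <= x * (b + y) + a * y.
Proof.
move=> Ax By A0a B0b.
have -> : A *m B - A0 *m B0 = (A - A0) *m B + A0 *m (B - B0).
  by rewrite mulmxBl mulmxBr addrA subrK.
have B_le : mxnorm1 B <= b + y.
  rewrite -[B](subrK B0); apply: (le_trans (mxnorm1D _ _)).
  by rewrite addrC; exact: lerD.
apply: (le_trans (mxnorm1D _ _)); apply: lerD; apply: (le_trans (mxnorm1M _ _)).
  by apply: ler_pM => //; exact: mxnorm1_ge0.
by apply: ler_pM => //; exact: mxnorm1_ge0.
Qed.

End GreenAmplitude.

(** * Amplitude and phase of the imaging integrand *)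

Section Integrand.
Context {R : realType}.
Local Open Scope complex_scope.
Local Notation normc := (@Normc.normc R).
Local Notation vec := 'rV[R]_3.
Local Notation mat := 'M[R[i]]_3.

Lemma conjmxZ (c : R[i]) (A : mat) :
  Defs.conjmx (c *: A) = conjc c *: Defs.conjmx A.
Proof. by apply/matrixP => i j; rewrite !mxE rmorphM. Qed.

Lemma conjmxB (A B : mat) :
  Defs.conjmx (A - B) = Defs.conjmx A - Defs.conjmx B.
Proof. by apply/matrixP => i j; rewrite !mxE rmorphB. Qed.

(** Each factor [L] offsets the decay of one amplitude. The grouping shows the two pairs around
    [alpha], which tend to [Ppar] and to the projector of the source. *)
Definition rescaled_integrand (alpha : mat) (ystar xs y : vec) (k L : R) (x : vec) : mat :=
  Defs.conjmx (L%:C *: amplitude k (x - y)) *m (L%:C *: amplitude k (x - ystar))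
  *m alpha *m
  ((L%:C *: amplitude k (ystar - xs)) *m Defs.conjmx (L%:C *: amplitude k (xs - y))).

Lemma scale_green_product (alpha A1 A2 A3 A4 : mat) (c1 c2 c3 c4 : R[i]) :
  Defs.conjmx (c1 *: A1) *m ((c2 *: A2) *m alpha *m (c3 *: A3)) *m Defs.conjmx (c4 *: A4) =
  (conjc c1 * c2 * c3 * conjc c4) *:
    (Defs.conjmx A1 *m A2 *m alpha *m (A3 *m Defs.conjmx A4)).
Proof.
rewrite 2!conjmxZ -!(scalemxAl, scalemxAr) !scalerA !mulmxA.
by congr (_ *: _); ring.
Qed.

Lemma scale_real_product (L : R) (alpha A1 A2 A3 A4 : mat) :
  Defs.conjmx (L%:C *: A1) *m (L%:C *: A2) *m alpha *m
    ((L%:C *: A3) *m Defs.conjmx (L%:C *: A4)) =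
  (L ^+ 4)%:C *: (Defs.conjmx A1 *m A2 *m alpha *m (A3 *m Defs.conjmx A4)).
Proof.
rewrite 2!conjmxZ -!(scalemxAl, scalemxAr) !scalerA !mulmxA.
have -> : conjc L%:C = L%:C by rewrite /= oppr0.
by congr (_ *: _); rewrite (rmorphXn (real_complex R)) /=; ring.
Qed.

(** Conjugation reverses the phases of the two Green functions attached to [y]. The phase from the
    source does not depend on [x] and is set apart, so that it leaves the integral as a constant of
    modulus 1. *)
Lemma integrandE (alpha : mat) (ystar xs y x : vec) (k L : R) : L != 0 ->
  Defs.conjmx (Green x y k) *m data alpha ystar x xs k *m Defs.conjmx (Green xs y k) =
  ((((4 * pi * L) ^+ 4)^-1)%:C
    * cis (k * (enorm3 (ystar - xs) - enorm3 (xs - y)))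
    * cis (k * (enorm3 (x - ystar) - enorm3 (x - y))))
  *: rescaled_integrand alpha ystar xs y k L x.
Proof.
move=> L0.
rewrite /data (GreenE x y) (GreenE x ystar) (GreenE ystar xs) (GreenE xs y).
rewrite scale_green_product /rescaled_integrand.
generalize (amplitude k (x - y)) (amplitude k (x - ystar))
  (amplitude k (ystar - xs)) (amplitude k (xs - y)) => A1 A2 A3 A4.
rewrite (scale_real_product L alpha A1 A2 A3 A4).
rewrite scalerA; congr (_ *: _).
have conj_phase (t c : R) : conjc (cis t * c%:C) = cis (- t) * c%:C.
  rewrite -conjc_cis (_ : conjc (cis t) * c%:C = conjc (cis t) * conjc c%:C).
    exact: rmorphM.
  by rewrite /= oppr0.
rewrite 2!conj_phase 2!mulrBr 2!cisD.
have -> : (((4 * pi * L) ^+ 4)^-1)%:C = ((4 * pi)^-1)%:C ^+ 4 * (L ^- 4)%:C :> R[i].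
  by rewrite -rmorphXn -rmorphM exprMn invfM exprVn.
have LV : (L ^- 4)%:C * (L ^+ 4)%:C = 1 :> R[i].
  by rewrite -(rmorphM (real_complex R)) mulVf ?expf_neq0.
set l := (L ^+ 4)%:C; set li := (L ^- 4)%:C; set c := ((4 * pi)^-1)%:C.
rewrite -/l -/li in LV.
set a1 := cis _; set a2 := cis _; set a3 := cis _; set a4 := cis _.
transitivity ((li * l) * (c ^+ 4 * a1 * a2 * a3 * a4)); first by rewrite LV; ring.
ring.
Qed.

Lemma mxnorm1_sandwich_approx (A B P Q alpha : mat) (b t : R) :
  mxnorm1 (A - P) <= t -> mxnorm1 (B - Q) <= t ->
  mxnorm1 P <= b -> mxnorm1 Q <= b ->
  mxnorm1 (A *m alpha *m B - P *m alpha *m Q) <= t * mxnorm1 alpha * (2 * b + t).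
Proof.
move=> AP BQ Pb Qb; have alpha0 := mxnorm1_ge0 alpha.
have Aa : mxnorm1 (A *m alpha - P *m alpha) <= t * mxnorm1 alpha.
  by rewrite -mulmxBl; apply: (le_trans (mxnorm1M _ _)); rewrite ler_wpM2r.
have Pa : mxnorm1 (P *m alpha) <= b * mxnorm1 alpha.
  by apply: (le_trans (mxnorm1M _ _)); rewrite ler_wpM2r.
apply: (le_trans (mxnorm1_mul_approx Aa BQ Pa Qb)).
rewrite (_ : _ + _ = t * mxnorm1 alpha * (2 * b + t))//; ring.
Qed.

(** Directions from imaging points to the array are close to [- y0], those between the source and
    the imaging window to [y0 - xs] up to sign, and [perpmx] is even. Each pair of amplitudes is
    thus near P P = P for a real projector P. *)
Lemma rescaled_integrand_approx : exists2 C : R, 0 < C &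
  forall (alpha : mat) (ystar xs y x : vec) (k L e : R),
  let y0 := point3 (0, 0) L in
  0 < k -> 0 < L -> enorm3 (xs - y0) = L -> e <= 14^-1 -> 1 / (k * L) <= e ->
  (forall i, `|(y - y0) 0 i| <= e * L) ->
  (forall i, `|(ystar - y0) 0 i| <= e * L) ->
  (forall i, `|(x - y + y0) 0 i| <= e * L) ->
  (forall i, `|(x - ystar + y0) 0 i| <= e * L) ->
  mxnorm1 (rescaled_integrand alpha ystar xs y k L x
    - Ppar *m alpha *m Pperp (y0 - xs)) <= C * e * mxnorm1 alpha.
Proof.
(* Two errors [684 * e] against norms at most 18 give [684 * e * (36 + 684 * e)], and [e <= 1]. *)
have [c c0 cE] : exists2 c : R, 0 < c & c = 684 * (36 + 684).
  by exists (684 * (36 + 684)); [lra|reflexivity].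
exists (c * (36 + c)); first by rewrite mulr_gt0// ltr_wpDl// ltW.
move=> alpha ystar xs y x k L e y0 k0 L0 xsL e14 kLe yy0 ysy0 xy xys.
have e0 : 0 < e by rewrite (lt_le_trans _ kLe)// divr_gt0// mulr_gt0.
have e1 : e <= 1 by lra.
have pair (A B P : mat) : P *m P = P -> mxnorm1 P <= 18 ->
    mxnorm1 (A - P) <= 684 * e -> mxnorm1 (B - P) <= 684 * e ->
    mxnorm1 (A *m B - P) <= c * e.
  move=> PP P18 AP BP; rewrite -[in X in _ - X]PP.
  apply: (le_trans (mxnorm1_mul_approx AP BP P18 P18)).
  have : e * e <= 1 * e by rewrite ler_pM2r.
  rewrite cE; lra.
have conj_approx (A P : mat) : Defs.conjmx P = P -> mxnorm1 (A - P) <= 684 * e ->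
    mxnorm1 (Defs.conjmx A - P) <= 684 * e.
  by move=> PE; rewrite -[in X in X -> _]mxnorm1_conj conjmxB PE.
have y0L : enorm3 (- y0) = L.
  apply/eqP; rewrite enorm3N -(@eqrXn2 _ 2) ?enorm3_ge0 ?ltW//.
  by rewrite enorm3_point3 /= expr0n !add0r.
have PparE' : Ppar = perpmx (- y0) :> mat by rewrite perpmxN (@PparE _ L) ?gt_eqF.
have xs0 : enorm3 (y0 - xs) = L by rewrite -enorm3N opprB.
have PsE : Pperp (y0 - xs) = perpmx (y0 - xs) :> mat.
  by apply: PperpE; rewrite xs0 gt_eqF.
have idem1 : perpmx (- y0) *m perpmx (- y0) = perpmx (- y0) :> mat.
  by rewrite -PparE'; exact: proj_ortho_proj.
have idem2 : perpmx (y0 - xs) *m perpmx (y0 - xs) = perpmx (y0 - xs) :> mat.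
  by rewrite -PsE; exact: proj_ortho_proj.
have A1 : mxnorm1 (L%:C *: amplitude k (x - y) - perpmx (- y0)) <= 684 * e.
  apply: amplitude_approx => // i; have := xy i; rewrite !mxE.
  by rewrite opprK.
have A2 : mxnorm1 (L%:C *: amplitude k (x - ystar) - perpmx (- y0)) <= 684 * e.
  apply: amplitude_approx => // i; have := xys i; rewrite !mxE.
  by rewrite opprK.
have A3 : mxnorm1 (L%:C *: amplitude k (ystar - xs) - perpmx (y0 - xs)) <= 684 * e.
  apply: amplitude_approx => // i; have := ysy0 i; rewrite !mxE.
  by rewrite opprB addrA subrK.
have A4 : mxnorm1 (L%:C *: amplitude k (xs - y) - perpmx (y0 - xs)) <= 684 * e.
  have -> : perpmx (y0 - xs) = perpmx (xs - y0)
    by rewrite -(opprB xs y0); exact: perpmxN.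
  apply: amplitude_approx => // i; have := yy0 i; rewrite !mxE.
  rewrite (_ : xs 0 i - y 0 i - (xs 0 i - _) = - (y 0 i - y0 0 i)) ?normrN ?mxE//.
  by ring.
have Q1 := pair _ _ _ idem1 (mxnorm1_perpmx _)
  (conj_approx _ _ (perpmx_conj _) A1) A2.
have Q2 := pair _ _ _ idem2 (mxnorm1_perpmx _)
  A3 (conj_approx _ _ (perpmx_conj _) A4).
rewrite /rescaled_integrand PparE' PsE.
have alpha0 := mxnorm1_ge0 alpha.
apply: (le_trans (mxnorm1_sandwich_approx alpha Q1 Q2 (mxnorm1_perpmx _) (mxnorm1_perpmx _))).
have -> : c * (36 + c) * e * mxnorm1 alpha = (c * e * mxnorm1 alpha) * (36 + c) by ring.
apply: ler_wpM2l; first by apply: mulr_ge0 => //; apply: mulr_ge0; exact: ltW.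
have -> : 2 * 18 + c * e = 36 + c * e by ring.
by rewrite lerD2l ler_piMr// ltW.
Qed.

(** In [(rs - r) * (rs + r)] the squares of [Z] and [p] cancel. What remains is quadratic in [q] and
    [qs], of order [b ^+ 2], plus twice the bilinear term. Replacing [rs + r] by [2 * Z] under the
    latter costs a relative error of order [a ^+ 2 / L ^+ 2]. *)
Lemma phase_approx (M c : R) : 0 < M -> 0 < c -> exists2 C : R, 0 < C &
  forall (k L Z a b : R) (p q qs : R * R),
  0 < k -> 0 < L -> L / 2 <= Z -> 0 < b -> b <= a ->
  `|p.1| <= M * a -> `|p.2| <= M * a ->
  `|q.1| <= c * b -> `|q.2| <= c * b -> `|qs.1| <= c * b -> `|qs.2| <= c * b ->
  `|k * (enorm3 (point3 p 0 - point3 qs Z) - enorm3 (point3 p 0 - point3 q Z))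
     - k / Z * (p.1 * (q.1 - qs.1) + p.2 * (q.2 - qs.2))|
  <= C * (k * b ^+ 2 / L + k * a ^+ 4 / L ^+ 3).
Proof.
(* The first summand bounds the quadratic term. In the second, 32 is 4 from the bilinear term, 4
   from [S - 2 * Z], and 2 from [S * Z >= L * (L / 2)]. *)
move=> M0 c0; exists (2 * c ^+ 2 + 32 * M * c * (M + c) ^+ 2).
  by rewrite addr_gt0// !mulr_gt0// ?exprn_gt0// addr_gt0.
move=> k L Z a b p q qs k0 L0 LZ b0 ba p1 p2 q1 q2 qs1 qs2.
have distribute (x y u v : R) : 0 <= x -> 0 <= y -> 0 <= u -> 0 <= v ->
    x * u + y * v <= (x + y) * (u + v) by nra.
have a0 : 0 < a by rewrite (lt_le_trans b0).
have Z0 : 0 < Z by rewrite (lt_le_trans _ LZ)// divr_gt0.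
have sqE (t : R * R) : enorm3 (point3 p 0 - point3 t Z) ^+ 2 =
    (p.1 - t.1) ^+ 2 + (p.2 - t.2) ^+ 2 + Z ^+ 2.
  by rewrite enorm3_sqr !big_ord_recl big_ord0 !mxE /= add0r sqrrN addr0 addrA.
set r := enorm3 (point3 p 0 - point3 q Z).
set rs := enorm3 (point3 p 0 - point3 qs Z).
have rE : r ^+ 2 = (p.1 - q.1) ^+ 2 + (p.2 - q.2) ^+ 2 + Z ^+ 2 by exact: sqE.
have rsE : rs ^+ 2 = (p.1 - qs.1) ^+ 2 + (p.2 - qs.2) ^+ 2 + Z ^+ 2 by exact: sqE.
have bound (t : R * R) (s : R) : `|t.1| <= c * b -> `|t.2| <= c * b -> 0 <= s ->
    s ^+ 2 = (p.1 - t.1) ^+ 2 + (p.2 - t.2) ^+ 2 + Z ^+ 2 ->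
    Z <= s <= Z + 2 * ((M + c) * a) ^+ 2 / L.
  move=> t1 t2 s0 sE.
  have cb : c * b <= c * a by rewrite ler_pM2l.
  have d2 (x y : R) : `|x| <= M * a -> `|y| <= c * b ->
      (x - y) ^+ 2 <= ((M + c) * a) ^+ 2.
    move=> hx hy; rewrite -real_normK ?num_real// !expr2; apply: ler_pM => //;
      apply: (le_trans (ler_normB _ _)); rewrite mulrDl; lra.
  have Zs : Z <= s.
    by rewrite -(@ler_sqr _ Z s) ?nnegrE ?(ltW Z0)// sE lerDr addr_ge0 ?sqr_ge0.
  rewrite Zs /=.
  have sZ : (s - Z) * (s + Z) <= 2 * ((M + c) * a) ^+ 2.
    by rewrite -subr_sqr sE; have := d2 _ _ p1 t1; have := d2 _ _ p2 t2; lra.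
  rewrite -lerBlDl ler_pdivlMr//; apply: le_trans sZ.
  by apply: ler_wpM2l; lra.
have /andP[Zr rZ] : Z <= r <= Z + 2 * ((M + c) * a) ^+ 2 / L.
  by apply: (bound q) => //; exact: enorm3_ge0.
have /andP[Zrs rsZ] : Z <= rs <= Z + 2 * ((M + c) * a) ^+ 2 / L.
  by apply: (bound qs) => //; exact: enorm3_ge0.
clear bound.
pose S := r + rs.
have S0 : 0 < S by rewrite /S; lra.
have LS : L <= S by rewrite /S; lra.
pose A := qs.1 ^+ 2 + qs.2 ^+ 2 - (q.1 ^+ 2 + q.2 ^+ 2).
pose B := p.1 * (q.1 - qs.1) + p.2 * (q.2 - qs.2).
have dE : (rs - r) * S = A + 2 * B.
  have -> : (rs - r) * S = rs ^+ 2 - r ^+ 2 by rewrite /S; ring.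
  by rewrite rE rsE /A /B; ring.
have -> : k * (rs - r) - k / Z * B = k * (A / S) - k * (B * (S - 2 * Z) / (S * Z)).
  have -> : rs - r = (A + 2 * B) / S by rewrite -dE mulfK// gt_eqF.
  by field; rewrite !gt_eqF.
have A_le : `|A| <= 2 * c ^+ 2 * b ^+ 2.
  have sq (x : R) : `|x| <= c * b -> 0 <= x ^+ 2 <= c ^+ 2 * b ^+ 2.
    move=> hx; rewrite sqr_ge0 -exprMn -real_normK ?num_real//= !expr2.
    by apply: ler_pM.
  have /andP[??] := sq _ q1; have /andP[??] := sq _ q2.
  have /andP[??] := sq _ qs1; have /andP[??] := sq _ qs2.
  by rewrite ler_norml /A; lra.
have B_le : `|B| <= 4 * M * c * a ^+ 2.
  have prod (x y z : R) : `|x| <= M * a -> `|y| <= c * b -> `|z| <= c * b ->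
      `|x * (y - z)| <= 2 * M * c * a ^+ 2.
    move=> hx hy hz; rewrite normrM.
    have -> : 2 * M * c * a ^+ 2 = (M * a) * (2 * (c * a)) by ring.
    apply: ler_pM => //; apply: (le_trans (ler_normB _ _)).
    have : c * b <= c * a by rewrite ler_pM2l.
    lra.
  apply: (le_trans (ler_normD _ _)).
  have := prod _ _ _ p1 q1 qs1; have := prod _ _ _ p2 q2 qs2; lra.
have S_le : `|S - 2 * Z| <= 4 * (M + c) ^+ 2 * a ^+ 2 / L.
  rewrite ger0_norm; last by rewrite /S; lra.
  have -> : 4 * (M + c) ^+ 2 * a ^+ 2 / L = 2 * (2 * ((M + c) * a) ^+ 2 / L).
    by rewrite exprMn; field; rewrite gt_eqF.
  by rewrite /S; lra.
apply: (le_trans (ler_normB _ _)).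
have T1 : `|k * (A / S)| <= 2 * c ^+ 2 * (k * b ^+ 2 / L).
  have -> : 2 * c ^+ 2 * (k * b ^+ 2 / L) = k * (2 * c ^+ 2 * b ^+ 2 / L) by ring.
  rewrite normrM (gtr0_norm k0) ler_pM2l// normrM normfV (gtr0_norm S0).
  by apply: ler_pM; rewrite ?invr_ge0 ?(ltW S0)// lef_pV2.
have T2 : `|k * (B * (S - 2 * Z) / (S * Z))| <=
    32 * M * c * (M + c) ^+ 2 * (k * a ^+ 4 / L ^+ 3).
  have -> : 32 * M * c * (M + c) ^+ 2 * (k * a ^+ 4 / L ^+ 3) =
    k * ((4 * M * c * a ^+ 2) * (4 * (M + c) ^+ 2 * a ^+ 2 / L) * (L * (L / 2))^-1).
    by field; rewrite gt_eqF.
  have SZ0 : 0 < S * Z by exact: mulr_gt0.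
  rewrite normrM (gtr0_norm k0) ler_pM2l// normrM normfV (gtr0_norm SZ0).
  apply: ler_pM; rewrite ?invr_ge0 ?(ltW SZ0)//.
    by rewrite normrM; apply: ler_pM.
  rewrite lef_pV2 ?posrE ?mulr_gt0 ?divr_gt0//.
  by apply: ler_pM => //; rewrite ?divr_ge0// ltW.
have t1 : 0 <= k * b ^+ 2 / L by rewrite divr_ge0 ?mulr_ge0 ?sqr_ge0 ?ltW.
have t2 : 0 <= k * a ^+ 4 / L ^+ 3 by rewrite divr_ge0 ?mulr_ge0 ?exprn_ge0 ?ltW.
apply: (le_trans (lerD T1 T2)).
have C1 : 0 <= 2 * c ^+ 2 by rewrite mulr_ge0 ?sqr_ge0.
have C2 : 0 <= 32 * M * c * (M + c) ^+ 2.
  by apply: mulr_ge0; [rewrite !mulr_ge0// ltW|exact: sqr_ge0].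
exact: distribute.
Qed.

End Integrand.

(** * Integration of matrix-valued functions *)

Section ComplexIntegral.
Context {R : realType}.
Local Open Scope complex_scope.
Local Notation normc := (@Normc.normc R).
Local Notation leb := (@lebesgue_measure R).
Local Notation leb2 := (leb \x leb)%E.
Local Notation plane := (measurableTypeR R * measurableTypeR R)%type.
Implicit Types f g : plane -> R[i].

Definition cmeasurable f :=
  measurable_fun setT (fun p => complex.Re (f p)) /\
  measurable_fun setT (fun p => complex.Im (f p)).

Lemma cmeasurable_cst c : cmeasurable (fun=> c).
Proof. by split; exact: measurable_cst. Qed.

Lemma cmeasurableD f g : cmeasurable f -> cmeasurable g ->
  cmeasurable (fun p => f p + g p).
Proof.
move=> [f1 f2] [g1 g2]; split.
- rewrite (_ : (fun p => _) = (fun p => complex.Re (f p)) \+ (fun p => complex.Re (g p))).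
    exact: measurable_funD.
  by apply/funext => p /=; case: (f p) (g p) => [??] [??].
- rewrite (_ : (fun p => _) = (fun p => complex.Im (f p)) \+ (fun p => complex.Im (g p))).
    exact: measurable_funD.
  by apply/funext => p /=; case: (f p) (g p) => [??] [??].
Qed.

Lemma cmeasurableM f g : cmeasurable f -> cmeasurable g ->
  cmeasurable (fun p => f p * g p).
Proof.
move=> [f1 f2] [g1 g2]; split.
- rewrite (_ : (fun p => _) =
      ((fun p => complex.Re (f p)) \* (fun p => complex.Re (g p)))
      \- ((fun p => complex.Im (f p)) \* (fun p => complex.Im (g p)))).
    by apply: measurable_funB; exact: measurable_funM.
  by apply/funext => p /=; case: (f p) (g p) => [??] [??].
- rewrite (_ : (fun p => _) =
      ((fun p => complex.Re (f p)) \* (fun p => complex.Im (g p)))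
      \+ ((fun p => complex.Im (f p)) \* (fun p => complex.Re (g p)))).
    by apply: measurable_funD; exact: measurable_funM.
  by apply/funext => p /=; case: (f p) (g p) => [??] [??].
Qed.

Lemma cmeasurableN f : cmeasurable f -> cmeasurable (fun p => - f p).
Proof.
move=> mf; rewrite (_ : (fun p => _) = (fun p => (- 1) * f p)).
  by apply: cmeasurableM => //; exact: cmeasurable_cst.
by apply/funext => p; rewrite mulN1r.
Qed.

Lemma cmeasurable_sum n (F : 'I_n -> plane -> R[i]) :
  (forall i, cmeasurable (F i)) -> cmeasurable (fun p => \sum_i F i p).
Proof.
elim: n F => [|n IH] F mF.
  rewrite (_ : (fun p => _) = (fun=> 0)); first exact: cmeasurable_cst.
  by apply/funext => p; rewrite big_ord0.
rewrite (_ : (fun p => _) = (fun p => F ord0 p + \sum_i F (lift ord0 i) p)).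
  by apply: cmeasurableD => //; apply: IH.
by apply/funext => p; rewrite big_ord_recl.
Qed.

Lemma cmeasurable_real (f : plane -> R) : measurable_fun setT f ->
  cmeasurable (fun p => (f p)%:C).
Proof. by move=> mf; split => //; exact: measurable_cst. Qed.

Lemma cmeasurable_conj f : cmeasurable f -> cmeasurable (fun p => conjc (f p)).
Proof.
move=> [f1 f2]; split.
- by rewrite (_ : (fun p => _) = (fun p => complex.Re (f p)))//;
    apply/funext => p; case: (f p).
- rewrite (_ : (fun p => _) = \- (fun p => complex.Im (f p))).
    exact: measurable_funN.
  by apply/funext => p /=; case: (f p).
Qed.

Lemma cmeasurable_cis (f : plane -> R) : measurable_fun setT f ->
  cmeasurable (fun p => cis (f p)).
Proof.
move=> mf; split => /=.
- apply: (measurableT_comp _ mf).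
  by apply: continuous_measurable_fun; exact: continuous_cos.
- apply: (measurableT_comp _ mf).
  by apply: continuous_measurable_fun; exact: continuous_sin.
Qed.

(** On nonnegative reals the inverse is the power of exponent [-1], also at 0, where both are 0. The
    singular point of the Green function therefore needs no separate treatment. *)
Lemma measurable_funV_ge0 (f : plane -> R) : measurable_fun setT f ->
  (forall p, 0 <= f p) -> measurable_fun setT (fun p => (f p)^-1).
Proof.
move=> mf f0; rewrite (_ : (fun p => _) = (fun x => x `^ (-1)) \o f).
  by apply: (measurableT_comp _ mf); exact: measurable_powR.
by apply/funext => p /=; rewrite powR_inv1.
Qed.

(** Has the shape of an entry of [integralmx], so that these entries unfold to it. *)
Definition cint (A : set plane) f : R[i] :=
  Rintegral leb2 A (fun p => complex.Re (f p))
  +i* Rintegral leb2 A (fun p => complex.Im (f p)).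

Variables (A : set plane) (mA : measurable A) (Aoo : (leb2 A < +oo)%E).

Lemma Re_integrable f b : cmeasurable f -> (forall p, A p -> normc (f p) <= b) ->
  leb2.-integrable A (EFin \o (fun p => complex.Re (f p))).
Proof.
move=> [mf _] fb; apply: (bounded_integrable mA Aoo mf (c := b)) => p Ap.
exact: le_trans (normc_Re _) (fb _ Ap).
Qed.

Lemma Im_integrable f b : cmeasurable f -> (forall p, A p -> normc (f p) <= b) ->
  leb2.-integrable A (EFin \o (fun p => complex.Im (f p))).
Proof.
move=> [_ mf] fb; apply: (bounded_integrable mA Aoo mf (c := b)) => p Ap.
exact: le_trans (normc_Im _) (fb _ Ap).
Qed.

Lemma cintB f g b c : cmeasurable f -> cmeasurable g ->
  (forall p, A p -> normc (f p) <= b) -> (forall p, A p -> normc (g p) <= c) ->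
  cint A f - cint A g = cint A (fun p => f p - g p).
Proof.
move=> mf mg fb gc; rewrite /cint.
have ReB (z t : R[i]) : complex.Re (z - t) = complex.Re z - complex.Re t.
  by case: z t => [??] [??].
have ImB (z t : R[i]) : complex.Im (z - t) = complex.Im z - complex.Im t.
  by case: z t => [??] [??].
under [in RHS]eq_Rintegral do rewrite ReB.
under [X in _ = _ +i* X]eq_Rintegral do rewrite ImB.
rewrite !RintegralB//.
- exact: Im_integrable fb.
- exact: Im_integrable gc.
- exact: Re_integrable fb.
- exact: Re_integrable gc.
Qed.

Lemma normc_cint_le f b : cmeasurable f -> (forall p, A p -> normc (f p) <= b) ->
  normc (cint A f) <= 2 * b * area A.
Proof.
move=> [mf1 mf2] fb; apply: (le_trans (normc_le _)) => /=.
have -> : 2 * b * area A = b * area A + b * area A by ring.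
apply: lerD; apply: le_normr_bounded_Rintegral => // p Ap.
- exact: le_trans (normc_Re _) (fb _ Ap).
- exact: le_trans (normc_Im _) (fb _ Ap).
Qed.

Lemma cintZr f b (c : R[i]) : cmeasurable f -> (forall p, A p -> normc (f p) <= b) ->
  cint A (fun p => f p * c) = cint A f * c.
Proof.
move=> mf fb; case: c => c1 c2; rewrite /cint; simpc.
have If1 := Re_integrable mf fb; have If2 := Im_integrable mf fb.
have scaled (h : plane -> R) (c : R) : leb2.-integrable A (EFin \o h) ->
    leb2.-integrable A (EFin \o (fun p => h p * c)).
  move=> ih; rewrite (_ : EFin \o _ = (fun p => (EFin \o h) p * c%:E)%E).
    exact: integrableZr.
  by apply/funext => p; rewrite /= EFinM.
congr (_ +i* _).
- rewrite -!RintegralZr// -RintegralB//; try exact: scaled.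
  by apply: eq_Rintegral => p _; case: (f p).
- rewrite -!RintegralZr// -RintegralD//; try exact: scaled.
  by apply: eq_Rintegral => p _; case: (f p).
Qed.

End ComplexIntegral.

(** * Measurability of the Green function *)

Section GreenMeasurable.
Context {R : realType}.
Local Open Scope complex_scope.
Local Notation plane := (measurableTypeR R * measurableTypeR R)%type.
Local Notation mat := 'M[R[i]]_3.
Implicit Types F G : plane -> mat.

Definition mxmeasurable F := forall i j, cmeasurable (fun p => F p i j).

Lemma mxmeasurable_cst (M : mat) : mxmeasurable (fun=> M).
Proof. by move=> i j; exact: cmeasurable_cst. Qed.

Lemma mxmeasurableM F G : mxmeasurable F -> mxmeasurable G ->
  mxmeasurable (fun p => F p *m G p).
Proof.
move=> mF mG i j; rewrite (_ : (fun p => _) = (fun p => \sum_k F p i k * G p k j)).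
  by apply: cmeasurable_sum => k; exact: cmeasurableM.
by apply/funext => p; rewrite mxE.
Qed.

Lemma mxmeasurable_conj F : mxmeasurable F -> mxmeasurable (fun p => Defs.conjmx (F p)).
Proof.
move=> mF i j; rewrite (_ : (fun p => _) = (fun p => conjc (F p i j))).
  exact: cmeasurable_conj.
by apply/funext => p; rewrite mxE.
Qed.

Lemma mxmeasurable_Green (y : 'rV[R]_3) (k : R) :
  mxmeasurable (fun p => Green (point3 p 0) y k).
Proof.
have mcoord l : measurable_fun setT (fun p : plane => (point3 p 0 - y) 0 l).
  rewrite (_ : (fun p => _) = (fun p : plane => [:: p.1; p.2; 0]`_l) \- (fun=> y 0 l)).
    apply: measurable_funB; last exact: measurable_cst.
    by case: l => [[|[|[|l]]] hl] //=;
      [exact: measurable_fst|exact: measurable_snd].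
  by apply/funext => p; rewrite !mxE.
have mr : measurable_fun setT (fun p : plane => enorm3 (point3 p 0 - y)).
  rewrite (_ : (fun p => _) = Num.sqrt \o
      (fun p : plane => (point3 p 0 - y) 0 ord0 ^+ 2
         + (point3 p 0 - y) 0 (lift ord0 ord0) ^+ 2
         + (point3 p 0 - y) 0 (lift ord0 (lift ord0 ord0)) ^+ 2)).
    apply: measurableT_comp.
      by apply: continuous_measurable_fun; exact: sqrt_continuous.
    by apply: measurable_funD; [apply: measurable_funD|]; apply: measurable_funX.
  by apply/funext => p; rewrite /enorm3 /= !big_ord_recl big_ord0 addr0 addrA.
have mkr : measurable_fun setT (fun p : plane => k * enorm3 (point3 p 0 - y)).
  by apply: measurable_funM => //; exact: measurable_cst.
have mm : cmeasurable (fun p => mcoef (k * enorm3 (point3 p 0 - y))).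
  rewrite (_ : (fun p => _) = (fun p => ('i * (k * enorm3 (point3 p 0 - y))%:C + (- 1))
      * (((k * enorm3 (point3 p 0 - y)) ^+ 2)^-1)%:C)).
    apply: cmeasurableM.
      apply: cmeasurableD; last exact: cmeasurable_cst.
      by apply: cmeasurableM; [exact: cmeasurable_cst|exact: cmeasurable_real].
    apply: cmeasurable_real; apply: measurable_funV_ge0.
      exact: measurable_funX.
    by move=> p; exact: sqr_ge0.
  by apply/funext => p; rewrite /mcoef realcV.
move=> i j; rewrite (_ : (fun p => _) = (fun p =>
  (cis (k * enorm3 (point3 p 0 - y)) * ((4 * pi)^-1)%:C) *
  ((enorm3 (point3 p 0 - y))^-1%:C *
   ((1 + mcoef (k * enorm3 (point3 p 0 - y))) * (i == j)%:R +
    - ((1 + 3 * mcoef (k * enorm3 (point3 p 0 - y)))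
       * ((enorm3 (point3 p 0 - y)) ^+ 2)^-1%:C
       * ((point3 p 0 - y) 0 i * (point3 p 0 - y) 0 j)%:C))))); last first.
  by apply/funext => p; rewrite GreenE mxE amplitudeE.
apply: cmeasurableM.
  by apply: cmeasurableM; [exact: cmeasurable_cis|exact: cmeasurable_cst].
apply: cmeasurableM.
  apply: cmeasurable_real; apply: measurable_funV_ge0 => // p; exact: enorm3_ge0.
apply: cmeasurableD.
  apply: cmeasurableM; last exact: cmeasurable_cst.
  by apply: cmeasurableD => //; exact: cmeasurable_cst.
apply: cmeasurableN; apply: cmeasurableM; last first.
  by apply: cmeasurable_real; exact: measurable_funM.
apply: cmeasurableM.
  apply: cmeasurableD; first exact: cmeasurable_cst.
  by apply: cmeasurableM => //; exact: cmeasurable_cst.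
apply: cmeasurable_real; apply: measurable_funV_ge0.
  exact: measurable_funX.
by move=> p; exact: sqr_ge0.
Qed.

End GreenMeasurable.

(** * Approximation of the imaging function *)

Section KirchhoffApproximation.
Context {R : realType}.
Local Open Scope complex_scope.
Local Notation normc := (@Normc.normc R).
Local Notation leb := (@lebesgue_measure R).
Local Notation leb2 := (leb \x leb)%E.
Local Notation plane := (measurableTypeR R * measurableTypeR R)%type.
Local Notation vec := 'rV[R]_3.
Local Notation mat := 'M[R[i]]_3.

(** [Theta_b < 1 < Theta_a] compares [b] with [a]. Moreover [a < L < k * a ^+ 2] yields
    [k * a >= 1], from which the other two bounds follow. *)
Lemma fraunhofer_set_scales (Ckh d : R) (p : params R) : 0 < d -> d <= 1 ->
  fraunhofer_set Ckh d p ->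
  [/\ par_b p <= par_a p, 1 / (par_k p * par_L p) <= par_a p / par_L p &
      par_h p <= Ckh * par_a p].
Proof.
move=> d0 d1 [[k0 L0 a0 b0 h0] [[kL aL _ _] [Tb Ta _ kh]]].
set k := par_k p in k0 kL kh *; set L := par_L p in L0 kL aL *.
set a := par_a p in a0 aL *; set b := par_b p in b0 *; set h := par_h p in h0 kh *.
have Ta1 : 1 < k * a ^+ 2 / L.
  have T0 : 0 < Theta_a p by rewrite /Theta_a divr_gt0// mulr_gt0// exprn_gt0.
  have := lt_le_trans Ta d1; rewrite ltr_pdivrMr// mul1r; exact.
have Tb1 : k * b ^+ 2 / L < 1 by exact: lt_le_trans Tb d1.
have aL1 : a < L by rewrite -[L]mul1r -ltr_pdivrMr//; exact: lt_le_trans aL d1.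
have Lka : L < k * a ^+ 2 by move: Ta1; rewrite ltr_pdivlMr// mul1r.
have ka : 1 <= k * a.
  rewrite -(ler_pM2r a0) mul1r -mulrA -expr2; apply: ltW.
  exact: lt_trans aL1 Lka.
split.
- have kb : k * b ^+ 2 < k * a ^+ 2.
    by apply: lt_trans Lka; move: Tb1; rewrite ltr_pdivrMr// mul1r.
  move: kb; rewrite ltr_pM2l// => kb; apply: ltW.
  by rewrite -ltr_sqr ?nnegrE//; exact: ltW.
- rewrite mul1r invfM ler_pM2r ?invr_gt0//.
  by rewrite -div1r ler_pdivrMr// mulrC.
- rewrite -(ler_pM2l k0); apply: (le_trans kh).
  have C0 : 0 <= Ckh by apply: le_trans kh; rewrite mulr_ge0 ?ltW.
  by rewrite mulrCA ler_peMr.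
Qed.

Lemma invr_4piX4_le (L : R) : 0 < L ->
  0 <= ((4 * pi * L) ^+ 4)^-1 /\ ((4 * pi * L) ^+ 4)^-1 <= L ^- 4.
Proof.
move=> L0; have pi4 : 1 <= 4 * pi :> R by have := pi_ge2 R; lra.
have piL : L <= 4 * pi * L by rewrite -[leLHS]mul1r ler_pM2r.
have piL0 : 0 < 4 * pi * L by exact: lt_le_trans piL.
split; first by rewrite invr_ge0 exprn_ge0// ltW.
rewrite lef_pV2 ?posrE ?exprn_gt0//.
by apply: lerXn2r; rewrite ?nnegrE ?(ltW L0) ?(ltW piL0).
Qed.

Lemma remainderE (p : params R) : par_L p != 0 ->
  remainder p = par_k p * par_a p ^+ 4 / par_L p ^+ 3
    + par_k p * par_b p ^+ 2 / par_L p + par_a p / par_L p.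
Proof.
move=> L0; rewrite /remainder /Theta_a /Theta_b; congr (_ + _ + _).
by field.
Qed.

Lemma mxnorm1_limit_product : exists2 B : R, 0 < B &
  forall (alpha : mat) (v : vec), enorm3 v != 0 ->
    mxnorm1 (Ppar *m alpha *m Pperp v) <= B * mxnorm1 alpha.
Proof.
exists (18 * 18); first by apply: mulr_gt0; rewrite ltr0n.
move=> alpha v v0; rewrite (@PparE _ 1) ?oner_eq0// (PperpE v0).
have -> : 18 * 18 * mxnorm1 alpha = 18 * mxnorm1 alpha * 18 by ring.
apply: (le_trans (mxnorm1M _ _)).
apply: ler_pM; [exact: mxnorm1_ge0|exact: mxnorm1_ge0| |exact: mxnorm1_perpmx].
apply: (le_trans (mxnorm1M _ _)); apply: ler_wpM2r; first exact: mxnorm1_ge0.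
exact: mxnorm1_perpmx.
Qed.

(** The factor 9 counts entries, the factor 2 real and imaginary parts. *)
Lemma integralmx_approx (A : set plane) (F : plane -> mat) (phi : plane -> R[i])
    (P : mat) (E : R) :
  measurable A -> (leb2 A < +oo)%E -> mxmeasurable F -> cmeasurable phi ->
  (forall x, normc (phi x) <= 1) ->
  (forall x, A x -> mxnorm1 (F x - phi x *: P) <= E) ->
  mxnorm1 (integralmx A F - cint A phi *: P) <= 9 * (2 * E * area A).
Proof.
move=> mA Aoo mF mphi phi1 FE; apply: mxnorm1_le => i j.
have bphi x : A x -> normc (phi x * P i j) <= normc (P i j).
  by move=> _; rewrite normcM ler_piMl ?normc_ge0.
have mphiP : cmeasurable (fun x => phi x * P i j).
  by apply: cmeasurableM => //; exact: cmeasurable_cst.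
have dist x : A x -> normc (F x i j - phi x * P i j) <= E.
  move=> Ax; apply: le_trans (FE x Ax); apply: le_trans (mxnorm1_entry _ i j).
  by rewrite !mxE.
have bF x : A x -> normc (F x i j) <= E + normc (P i j).
  move=> Ax; rewrite -[F x i j](subrK (phi x * P i j)).
  by apply: (le_trans (normcD _ _)); apply: lerD; [exact: dist|exact: bphi].
have -> : (integralmx A F - cint A phi *: P) i j =
    cint A (fun x => F x i j - phi x * P i j).
  rewrite -(cintB mA Aoo (mF i j) mphiP bF bphi).
  rewrite (cintZr mA Aoo (P i j) mphi (b := 1)) => [|x _]; last exact: phi1.
  by rewrite !mxE.
apply: normc_cint_le => //.
by apply: cmeasurableD => //; exact: cmeasurableN.
Qed.

(** The integral [J] is left unevaluated so that both cases can use the result: (i) bounds [J], (ii)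
    takes [q = qs] and computes it. The bounds on [Z] serve (i). *)
Lemma kirchhoff_approx (D : set (R * R)) (Cy Ceta Ckh : R) :
  piecewise_smooth_domain D -> 0 < Cy -> 0 < Ceta -> 0 < Ckh ->
  exists2 C : R, 0 < C & \forall p \near fraunhofer Ckh,
    let k := par_k p in
    let L := par_L p in
    let a := par_a p in
    forall (xs : vec) (qs q : R * R) (eta : R) (alpha : mat),
      enorm3 (xs - point3 (0, 0) L) = L ->
      enorm2 qs <= Cy * par_b p -> enorm2 q <= Cy * par_b p ->
      `|eta| <= Ceta * par_h p ->
      let Z := L + eta in
      let P := Ppar *m alpha *m Pperp (point3 (0, 0) L - xs) in
      let c := cis (k * (enorm3 (point3 qs Z - xs) - enorm3 (xs - point3 q Z))) in
      let J := cint (array a D) (fun x =>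
        cis (k / Z * (x.1 * (q.1 - qs.1) + x.2 * (q.2 - qs.2)))) in
      [/\ L / 2 <= Z, Z <= 2 * L &
        mxnorm1 (kirchhoff (array a D) alpha (point3 qs Z) xs (point3 q Z) k
          - ((((4 * pi * L) ^+ 4)^-1)%:C * c * J) *: P)
        <= C * remainder p * (a ^+ 2 / L ^+ 4) * mxnorm1 alpha].
Proof.
move=> hD Cy0 Ceta0 Ckh0.
have [M M0 hM] := array_bounded hD.
have [c' [Ca [_ Ca0 hCa]]] := array_area hD.
have [Cp Cp0 hCp] := phase_approx M0 Cy0.
have [Ci Ci0 hCi] := @rescaled_integrand_approx R.
have [B B0 hB] := mxnorm1_limit_product.
(* Bounds every displacement in units of [a]: [M + Cy] horizontally, [Ceta * Ckh] in depth. The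
   summand 1 accounts for [1 / (k * L)]. *)
pose c1 := 1 + M + Cy + Ceta * Ckh.
have c10 : 0 < c1 by rewrite /c1 !addr_gt0// mulr_gt0.
have CC0 : 0 <= Ceta * Ckh by rewrite mulr_ge0// ltW.
have c11 : 1 <= c1 by rewrite /c1; lra.
have c1_ge : Ceta * Ckh <= c1 by rewrite /c1; lra.
have Cyc1 : Cy <= c1 by rewrite /c1; lra.
have MCyc1 : M + Cy <= c1 by rewrite /c1; lra.
have C0 : 0 < Ci * c1 + 2 * B * Cp.
  by apply: addr_gt0; apply: mulr_gt0 => //; apply: mulr_gt0.
exists (18 * Ca * (Ci * c1 + 2 * B * Cp)).
  by apply: mulr_gt0 => //; apply: mulr_gt0; rewrite // ltr0n.
(* Forces [e <= 28^-1]: this meets the threshold [14^-1] and keeps [Z] between [L / 2] and [2 * L].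
   The 1 is for [fraunhofer_set_scales]. *)
exists (Num.min 1 (28 * c1)^-1).
  by rewrite /= lt_min ltr01 invr_gt0 mulr_gt0.
move=> p hp /=.
have d0 : 0 < Num.min 1 (28 * c1)^-1 by rewrite lt_min ltr01 invr_gt0 mulr_gt0.
have d1 : Num.min 1 (28 * c1)^-1 <= 1 by rewrite ge_min lexx.
have [ba kL ha] := fraunhofer_set_scales d0 d1 hp.
move: hp => [[k0 L0 a0 b0 h0] [[_ aL _ _] _]].
have remE := remainderE (lt0r_neq0 L0).
set rem := remainder p in remE *.
set k := par_k p in k0 kL remE *; set L := par_L p in L0 kL aL remE *.
set a := par_a p in a0 ba kL ha aL remE *; set b := par_b p in b0 ba remE *.
set h := par_h p in h0 ha *.
move=> xs qs q eta alpha xsL qsb qb etah.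
pose e := c1 * (a / L).
have eL : e * L = c1 * a by rewrite /e mulrA divfK// gt_eqF.
have e0 : 0 < e by rewrite mulr_gt0// divr_gt0.
have e28 : e <= 28^-1.
  have : a / L <= (28 * c1)^-1.
    by apply/ltW/(lt_le_trans aL); rewrite ge_min lexx orbT.
  move=> aLc; rewrite /e (_ : 28^-1 = c1 * (28 * c1)^-1); first by rewrite ler_pM2l.
  by rewrite invfM mulrCA mulfV ?mulr1// gt_eqF.
have e14 : e <= 14^-1 by lra.
have eta_le : `|eta| <= e * L.
  apply: (le_trans etah); rewrite eL.
  apply: (@le_trans _ _ (Ceta * (Ckh * a))); first by rewrite ler_pM2l.
  by rewrite mulrA ler_pM2r.
have eL28 : e * L <= 28^-1 * L by rewrite ler_pM2r.
pose Z := L + eta.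
have LZ : L / 2 <= Z by move: eta_le; rewrite ler_norml /Z; lra.
have ZL : Z <= 2 * L by move: eta_le; rewrite ler_norml /Z; lra.
split => //.
have [Aoo _ areaA] := hCa a a0.
set y0 := point3 (0, 0) L in xsL *.
set ys := point3 qs (L + eta); set y := point3 q (L + eta).
set P := Ppar *m alpha *m Pperp (y0 - xs).
set c := cis (k * (enorm3 (ys - xs) - enorm3 (xs - y))).
set phi := fun x : plane => cis (k / (L + eta) * (x.1 * (q.1 - qs.1) + x.2 * (q.2 - qs.2))).
pose K : R := ((4 * pi * L) ^+ 4)^-1.
rewrite -/K.
have xs0 : enorm3 (y0 - xs) != 0 by rewrite -enorm3N opprB xsL gt_eqF.
have P_le : mxnorm1 P <= B * mxnorm1 alpha by exact: hB.
have rem_ge : a / L <= rem /\ k * b ^+ 2 / L + k * a ^+ 4 / L ^+ 3 <= rem.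
  have : 0 <= k * a ^+ 4 / L ^+ 3.
    by apply: divr_ge0; [apply: mulr_ge0; [exact: ltW|exact/exprn_ge0/ltW]|exact/exprn_ge0/ltW].
  have : 0 <= k * b ^+ 2 / L.
    by apply: divr_ge0; [apply: mulr_ge0; [exact: ltW|exact: sqr_ge0]|exact: ltW].
  have : 0 <= a / L by apply: divr_ge0; exact: ltW.
  by rewrite remE; lra.
have alpha0 := mxnorm1_ge0 alpha.
have [K0 KL] : 0 <= K /\ K <= L ^- 4 by exact: invr_4piX4_le.
have qc (t : R * R) : enorm2 t <= Cy * b -> `|t.1| <= Cy * b /\ `|t.2| <= Cy * b.
  by move=> h'; have [h1 h2] := enorm2_le t; split; [exact: le_trans h1 h'|exact: le_trans h2 h'].
have [q1 q2] := qc _ qb; have [qs1 qs2] := qc _ qsb.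
have Cyb : Cy * b <= Cy * a by rewrite ler_pM2l.
have Cya : Cy * b <= c1 * a.
  by apply: (le_trans Cyb); rewrite ler_pM2r.
have MCya : M * a + Cy * b <= c1 * a.
  apply: (@le_trans _ _ (M * a + Cy * a)); first by rewrite lerD2l.
  by rewrite -mulrDl ler_pM2r.
have far (t : R * R) : `|t.1| <= Cy * b -> `|t.2| <= Cy * b ->
    forall i, `|(point3 t (L + eta) - y0) 0 i| <= e * L.
  move=> t1 t2 i; rewrite !mxE; case: i => [[|[|[|i]]] hi] //=.
  - by rewrite subr0 eL; exact: le_trans Cya.
  - by rewrite subr0 eL; exact: le_trans Cya.
  - by rewrite addrAC subrr add0r.
have close (t x : R * R) : `|t.1| <= Cy * b -> `|t.2| <= Cy * b ->
    `|x.1| <= M * a -> `|x.2| <= M * a ->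
    forall i, `|(point3 x 0 - point3 t (L + eta) + y0) 0 i| <= e * L.
  have step (u v : R) : `|u| <= M * a -> `|v| <= Cy * b -> `|u - v + 0| <= c1 * a.
    move=> hu hv; rewrite addr0; apply: (le_trans (ler_normB _ _)).
    exact: le_trans (lerD hu hv) MCya.
  move=> t1 t2 x1 x2 i; rewrite !mxE; case: i => [[|[|[|i]]] hi] //=.
  - by rewrite eL; exact: step.
  - by rewrite eL; exact: step.
  - by rewrite sub0r opprD addrAC addNr add0r normrN.
have kLe : 1 / (k * L) <= e.
  apply: (le_trans kL); rewrite /e -[leLHS]mul1r; apply: ler_wpM2r => //.
  by apply: divr_ge0; exact: ltW.
have mphi : cmeasurable phi.
  apply: cmeasurable_cis; apply: measurable_funM; first exact: measurable_cst.
  by apply: measurable_funD; apply: measurable_funM; try exact: measurable_cst;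
    [exact: measurable_fst|exact: measurable_snd].
pose F (x : plane) : mat :=
  Defs.conjmx (Green (point3 x 0) y k) *m data alpha ys (point3 x 0) xs k
  *m Defs.conjmx (Green xs y k).
have mF : mxmeasurable F.
  rewrite /F /data; apply: mxmeasurableM; last exact: mxmeasurable_cst.
  apply: mxmeasurableM; first by apply: mxmeasurable_conj; exact: mxmeasurable_Green.
  apply: mxmeasurableM; last exact: mxmeasurable_cst.
  by apply: mxmeasurableM; [exact: mxmeasurable_Green|exact: mxmeasurable_cst].
pose E := L ^- 4 * ((Ci * c1 + 2 * B * Cp) * rem * mxnorm1 alpha).
have pointwise x : array a D x -> mxnorm1 (F x - phi x *: ((K%:C * c) *: P)) <= E.
  move=> Ax; have [x1 x2] := hM a x a0 Ax.
  rewrite /F (@integrandE _ alpha ys xs y (point3 x 0) k L) ?gt_eqF// -/K -/c.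
  set Y := rescaled_integrand _ _ _ _ _ _ _.
  set theta := k * _.
  (* Separates the amplitude error, under the exact phase, from the phase error, on the fixed matrix
     [P]. *)
  have -> : (K%:C * c * cis theta) *: Y - phi x *: ((K%:C * c) *: P) =
      (K%:C * c) *: (cis theta *: (Y - P) + (cis theta - phi x) *: P).
    rewrite scalerA scalerDr !scalerA scalerBr mulrBr scalerBl addrA subrK.
    by congr (_ - _ *: _); rewrite mulrC.
  rewrite mxnorm1Z normcM normc_cis normc_real mulr1 ger0_norm//.
  apply: ler_pM => //; first exact: mxnorm1_ge0.
  have YP : mxnorm1 (Y - P) <= Ci * e * mxnorm1 alpha.
    by apply: (hCi alpha ys xs y (point3 x 0) k L e) => //;
      [exact: far|exact: far|exact: close|exact: close].
  have phase : normc (cis theta - phi x) <= 2 * (Cp * rem).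
    apply: (le_trans (normc_cisB _ _)); rewrite ler_pM2l//.
    apply: (@le_trans _ _ (Cp * (k * b ^+ 2 / L + k * a ^+ 4 / L ^+ 3))).
      exact: hCp.
    by rewrite ler_pM2l//; exact: rem_ge.2.
  apply: (le_trans (mxnorm1D _ _)); rewrite !mxnorm1Z normc_cis mul1r.
  have -> : (Ci * c1 + 2 * B * Cp) * rem * mxnorm1 alpha =
    Ci * (c1 * rem) * mxnorm1 alpha + 2 * (Cp * rem) * (B * mxnorm1 alpha) by ring.
  apply: lerD.
    apply: (le_trans YP); apply: ler_wpM2r => //; rewrite ler_pM2l// /e ler_pM2l//.
    exact: rem_ge.1.
  by apply: ler_pM => //; [exact: normc_ge0|exact: mxnorm1_ge0].
have phi1 x : normc (phi x) <= 1 by rewrite normc_cis.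
have := integralmx_approx (measurable_array hD a0) Aoo mF mphi phi1 pointwise.
rewrite scalerA (mulrC (cint _ _)) => /le_trans; apply.
have -> : 18 * Ca * (Ci * c1 + 2 * B * Cp) * rem * (a ^+ 2 / L ^+ 4) * mxnorm1 alpha =
    9 * (2 * E * (Ca * a ^+ 2)) by rewrite /E; ring.
rewrite ler_pM2l// ; apply: ler_wpM2l => //.
apply: mulr_ge0 => //; apply: mulr_ge0; first by rewrite invr_ge0 exprn_ge0// ltW.
apply: mulr_ge0 => //; apply: mulr_ge0; first exact: ltW.
by apply: le_trans rem_ge.1; apply: divr_ge0; exact: ltW.
Qed.

End KirchhoffApproximation.

(** * From the approximation to the two asymptotic statements *)

Section Asymptotics.
Context {R : realType}.
Local Open Scope complex_scope.
Local Notation normc := (@Normc.normc R).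
Local Notation plane := (measurableTypeR R * measurableTypeR R)%type.

Lemma enorm2Z (t : R) (w : R * R) : 0 <= t -> enorm2 (t * w.1, t * w.2) = t * enorm2 w.
Proof.
by move=> t0; rewrite /enorm2 /= !exprMn -mulrDr sqrtrM ?sqr_ge0// sqrtr_sqr ger0_norm.
Qed.

(** Real and imaginary parts are both cosine integrals, with phases 0 and [- (pi / 2)]; hence the
    doubled constant. *)
Lemma normc_cint_cis_le (D : set (R * R)) : piecewise_smooth_domain D ->
  exists2 C, 0 < C & forall (a t : R) (w : R * R), 0 < a -> 0 < t -> w != 0 ->
    normc (cint (array a D) (fun x : plane => cis (t * (x.1 * w.1 + x.2 * w.2))))
      <= C * (a / (t * enorm2 w)).
Proof.
move=> hD; have [C C0 hC] := oscillatory_integral_bound hD.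
exists (2 * C); first by rewrite mulr_gt0.
move=> a t w a0 t0 w0; apply: (le_trans (normc_le _)) => /=.
have tw0 : (t * w.1, t * w.2) != 0 :> R * R.
  apply: contra w0 => /eqP[/eqP h1 /eqP h2].
  rewrite [w]surjective_pairing; apply/eqP.
  by move: h1 h2; rewrite !mulf_eq0 !(gt_eqF t0) => /eqP-> /eqP->.
have bound phi := hC a (t * w.1, t * w.2) phi a0 tw0.
rewrite enorm2Z ?(ltW t0)// /= in bound.
have -> : 2 * C * (a / (t * enorm2 w)) =
  C * (a / (t * enorm2 w)) + C * (a / (t * enorm2 w)) by ring.
apply: lerD.
- apply: le_trans (bound 0); rewrite le_eqVlt; apply/orP; left; apply/eqP.
  by congr `|_|; apply: eq_Rintegral => x _; congr cos; ring.
- apply: le_trans (bound (- (pi / 2))); rewrite le_eqVlt; apply/orP; left; apply/eqP.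
  by congr `|_|; apply: eq_Rintegral => x _; rewrite cosBpihalf; congr sin; ring.
Qed.

Lemma remainder_terms_gt0 (p : params R) :
  0 < par_k p -> 0 < par_L p -> 0 < par_a p -> 0 < par_b p ->
  [/\ 0 < par_a p ^+ 2 * Theta_a p / par_L p ^+ 2, 0 < Theta_b p &
      0 < par_a p / par_L p].
Proof.
move=> k0 L0 a0 b0; split; last exact: divr_gt0.
- by rewrite divr_gt0 ?exprn_gt0// mulr_gt0 ?exprn_gt0// divr_gt0// mulr_gt0// exprn_gt0.
- by rewrite divr_gt0// mulr_gt0// exprn_gt0.
Qed.

(** The first term equals [Theta_a] over [L ^+ 2 / a ^+ 2], so each of the three terms is a ratio
    that the regime makes small. *)
Lemma remainder_cvg0 (Ckh : R) : remainder p @[p --> fraunhofer Ckh] --> (0 : R).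
Proof.
apply/cvgrPdist_lt => e e0; exists (e / 3); first by rewrite /= divr_gt0.
move=> p [[k0 L0 a0 b0 h0] [[_ aL _ _] [Tb _ Ta _]]].
have [t1 t2 t3] := remainder_terms_gt0 k0 L0 a0 b0.
have e1 : par_a p ^+ 2 * Theta_a p / par_L p ^+ 2 =
    Theta_a p / (par_L p ^+ 2 / par_a p ^+ 2).
  by field; rewrite (lt0r_neq0 L0) (lt0r_neq0 a0).
rewrite -e1 in Ta.
rewrite /= sub0r normrN /remainder ger0_norm; last by rewrite !addr_ge0// ltW.
lra.
Qed.

Lemma fraunhofer_positive (Ckh : R) : \forall p \near fraunhofer Ckh,
  [/\ 0 < par_k p, 0 < par_L p, 0 < par_a p & 0 < remainder p].
Proof.
exists 1; first by rewrite /= ltr01.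
move=> p [[k0 L0 a0 b0 h0] _]; split => //.
have [t1 t2 t3] := remainder_terms_gt0 k0 L0 a0 b0.
by rewrite /remainder !addr_gt0.
Qed.

(** The estimates bound the sum of two errors while (i) names each; sharing [T] in the proportion of
    [u] to [v] respects both bounds. *)
Lemma split_error (C T u v : R) : 0 < u -> 0 < v -> 0 <= T -> T <= C * (u + v) ->
  exists E1 E2, [/\ `|E1| <= C * u, `|E2| <= C * v & E1 + E2 = T].
Proof.
move=> u0 v0 T0 TC; have uv0 : 0 < u + v by rewrite addr_gt0.
have uvu : u + v != 0 by rewrite gt_eqF.
have part w : 0 < w -> `|T / (u + v) * w| <= C * w.
  move=> w0; rewrite normrM (gtr0_norm w0) ler_pM2r//.
  by rewrite ger0_norm ?ler_pdivrMr// divr_ge0// ltW.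
exists (T / (u + v) * u), (T / (u + v) * v); split; [exact: part|exact: part|].
by rewrite -mulrDr divfK.
Qed.

Lemma cint1 (A : set plane) : measurable A -> cint A (fun=> 1) = (area A)%:C.
Proof.
move=> mA; rewrite /cint /=; congr (_ +i* _).
  by rewrite Rintegral_cst// mul1r.
by rewrite Rintegral_cst// mul0r.
Qed.

Variables (N : 'M[R[i]]_3 -> R) (CN : R).
Hypotheses (CN0 : 0 < CN) (hCN : forall A, N A <= CN * mxnorm1 A).

(* [J] stands for the oscillatory integral, of size [a ^+ 2 * u] with
   [u = L / (a * k * W)], and [v] for the remainder. *)
Lemma norm_kirchhoff_le (K P : 'M[R[i]]_3) (c J : R[i])
    (k L Z a W Co B Ck Abar v : R) :
  0 < k -> 0 < L -> 0 < a -> 0 < W -> 0 < v -> 0 < Co -> 0 < B -> 0 < Ck -> 0 < Abar ->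
  0 < Z -> Z <= 2 * L -> normc c = 1 ->
  normc J <= Co * (a / (k / Z * W)) -> mxnorm1 P <= B * Abar ->
  mxnorm1 (K - ((((4 * pi * L) ^+ 4)^-1)%:C * c * J) *: P)
    <= Ck * v * (a ^+ 2 / L ^+ 4) * Abar ->
  N K * ((4 * pi * L) ^+ 2 * (L ^+ 2 / a ^+ 2)) <=
    16 * pi ^+ 2 * CN * Abar * (2 * Co * B + Ck) * (L / (a * k * W) + v).
Proof.
move=> k0 L0 a0 W0 v0 Co0 B0 Ck0 Abar0 Z0 ZL c1 JC PB main.
have distribute (x y s t : R) : 0 < x -> 0 < y -> 0 < s -> 0 < t ->
    x * s + y * t <= (x + y) * (s + t) by nra.
set u := L / (a * k * W).
have u0 : 0 < u by rewrite divr_gt0// !mulr_gt0.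
have pi0 : 0 < (pi : R) by exact: pi_gt0.
have ne := (lt0r_neq0 k0, lt0r_neq0 L0, lt0r_neq0 a0, lt0r_neq0 W0, lt0r_neq0 Z0).
have J_le : normc J <= 2 * Co * (a ^+ 2 * u).
  apply: (le_trans JC).
  have -> : 2 * Co * (a ^+ 2 * u) = Co * (a / (k * W) * (2 * L)).
    by rewrite /u; field; rewrite !ne.
  have -> : Co * (a / (k / Z * W)) = Co * (a / (k * W) * Z) by field; rewrite !ne.
  by rewrite ler_pM2l// ler_pM2l// divr_gt0// mulr_gt0.
have [L40 L4] := invr_4piX4_le L0.
have K_le : mxnorm1 K <= a ^+ 2 / L ^+ 4 * Abar * ((2 * Co * B + Ck) * (u + v)).
  rewrite -[K](subrK (((((4 * pi * L) ^+ 4)^-1)%:C * c * J) *: P)).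
  apply: (le_trans (mxnorm1D _ _)).
  apply: (@le_trans _ _ (Ck * v * (a ^+ 2 / L ^+ 4) * Abar
      + L ^- 4 * (2 * Co * (a ^+ 2 * u)) * (B * Abar))).
    apply: lerD => //; rewrite mxnorm1Z !normcM c1 normc_real mulr1 ger0_norm//.
    apply: ler_pM => //; [by rewrite mulr_ge0 ?normc_ge0|exact: mxnorm1_ge0|].
    by apply: ler_pM => //; exact: normc_ge0.
  have -> : Ck * v * (a ^+ 2 / L ^+ 4) * Abar
      + L ^- 4 * (2 * Co * (a ^+ 2 * u)) * (B * Abar) =
    a ^+ 2 / L ^+ 4 * Abar * (2 * Co * B * u + Ck * v) by ring.
  apply: ler_wpM2l.
    by rewrite mulr_ge0 ?(ltW Abar0)// divr_ge0 ?sqr_ge0// exprn_ge0// ltW.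
  by apply: distribute => //; apply: mulr_gt0 => //; apply: mulr_gt0.
(* This factor is the inverse of the prefactor in (i); it turns [a ^+ 2 / L ^+ 4] into
   [16 * pi ^+ 2]. *)
have scale0 : 0 < (4 * pi * L) ^+ 2 * (L ^+ 2 / a ^+ 2).
  by rewrite mulr_gt0 ?divr_gt0 ?exprn_gt0 ?mulr_gt0.
have -> : 16 * pi ^+ 2 * CN * Abar * (2 * Co * B + Ck) * (u + v) =
  CN * (a ^+ 2 / L ^+ 4 * Abar * ((2 * Co * B + Ck) * (u + v)))
    * ((4 * pi * L) ^+ 2 * (L ^+ 2 / a ^+ 2)) by field; rewrite !ne.
rewrite ler_pM2r//; apply: (le_trans (hCN _)).
by rewrite ler_pM2l.
Qed.

End Asymptotics.

Theorem proposition2 (R : realType) (D : set (R * R))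
    (hD : piecewise_smooth_domain D)
    (N : 'M[R[i]]_3 -> R) (hN : matrix_norm N)
    (Cy Ceta Calpha Ckh : R)
    (hCy : 0 < Cy) (hCeta : 0 < Ceta) (hCalpha : 0 < Calpha)
    (hCkh : 0 < Ckh) :
  [/\ (* mes A = Theta(a^2) *)
      exists c C : R, [/\ 0 < c, 0 < C & forall a : R, 0 < a ->
        c * a ^+ 2 <= area (array a D) <= C * a ^+ 2],
      (* the explicit remainder of (i) is o(1) *)
      remainder p @[p --> fraunhofer Ckh] --> (0 : R),
      (* (i) *)
      exists2 C : R, 0 < C & \forall p \near fraunhofer Ckh,
        let k := par_k p in
        let L := par_L p in
        let a := par_a p in
        let b := par_b p in
        let h := par_h p in
        forall (xs : 'rV[R]_3) (ystarpar ypar : R * R) (etastar : R)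
            (alpha : 'M[R[i]]_3),
          enorm3 (xs - point3 (0, 0) L) = L ->
          enorm2 ystarpar <= Cy * b -> enorm2 ypar <= Cy * b ->
          `|etastar| <= Ceta * h ->
          (alpha^T)%R = alpha -> N alpha <= Calpha ->
          ypar <> ystarpar ->
          exists E1 E2 : R,
            [/\ `|E1| <= C * (L / (a * k * enorm2 (ypar - ystarpar))),
                `|E2| <= C * remainder p &
                N (kirchhoff (array a D) alpha (point3 ystarpar (L + etastar))
                     xs (point3 ypar (L + etastar)) k)
                = 1 / (4 * pi * L) ^+ 2 * (a ^+ 2 / L ^+ 2 * (E1 + E2))] &
      (* (ii) *)
      forall eps : R, 0 < eps -> \forall p \near fraunhofer Ckh,
        let k := par_k p in
        let L := par_L p in
        let a := par_a p in
        let b := par_b p in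
        let h := par_h p in
        forall (xs : 'rV[R]_3) (ystarpar : R * R) (etastar : R)
            (alpha : 'M[R[i]]_3),
          enorm3 (xs - point3 (0, 0) L) = L ->
          enorm2 ystarpar <= Cy * b ->
          `|etastar| <= Ceta * h ->
          (alpha^T)%R = alpha -> N alpha <= Calpha ->
          let ystar := point3 ystarpar (L + etastar) in
          exists E : 'M[R[i]]_3,
            N E <= eps * (a ^+ 2 / L ^+ 2) /\
            kirchhoff (array a D) alpha ystar xs ystar k
            = (1 / (4 * pi * L) ^+ 2)%:C%C *:
                ((area (array a D) / (4 * pi * L) ^+ 2)%:C%C *:
                   (Ppar *m alpha *m Pperp (point3 (0, 0) L - xs)) + E)].
Proof.
have [c [C [c0 C0 hcC]]] := array_area hD.
have [CN CN0 hCN] := matrix_norm_le_mxnorm1 hN.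
have [CN' CN'0 hCN'] := mxnorm1_le_matrix_norm hN.
have [Ck Ck0 hCk] := kirchhoff_approx hD hCy hCeta hCkh.
have [Co Co0 hCo] := normc_cint_cis_le hD.
have [B B0 hB] := @mxnorm1_limit_product R.
(* The hypothesis [N alpha <= Calpha] read in the entrywise norm. *)
pose Abar := CN' * Calpha.
have Abar0 : 0 < Abar by rewrite mulr_gt0.
have alpha_le (alpha : 'M[R[i]]_3) : N alpha <= Calpha -> mxnorm1 alpha <= Abar.
  by move=> h; apply: (le_trans (hCN' _)); rewrite ler_pM2l.
have pi0 : 0 < (pi : R) by exact: pi_gt0.
have remainder_bound (r s v x : R) : 0 <= s -> 0 <= v -> 0 <= x -> r <= Ck * v * s * x ->
    x <= Abar -> r <= Ck * v * s * Abar.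
  move=> s0 v0 x0 rx xA; apply: (le_trans rx); apply: ler_wpM2l => //.
  by rewrite mulr_ge0// mulr_ge0// ltW.
have unit_vec (L : R) (xs : 'rV[R]_3) : 0 < L -> enorm3 (xs - point3 (0, 0) L) = L ->
    enorm3 (point3 (0, 0) L - xs) != 0.
  by move=> L0 xsL; rewrite -enorm3N opprB xsL gt_eqF.
split.
- exists c, C; split => // a a0; have [_ h1 h2] := hcC a a0.
  by rewrite h1 h2.
- exact: remainder_cvg0.
- exists (16 * pi ^+ 2 * CN * Abar * (2 * Co * B + Ck)).
    by rewrite !mulr_gt0 ?exprn_gt0// addr_gt0// !mulr_gt0.
  apply: filterS2 (fraunhofer_positive Ckh) hCk => p [k0 L0 a0 rem0] hp /=.
  move=> xs qs q eta alpha xsL qsb qb etah _ Nalpha q_neq.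
  have [LZ ZL main] := hp xs qs q eta alpha xsL qsb qb etah.
  have Z0 : 0 < par_L p + eta by apply: lt_le_trans LZ; rewrite divr_gt0.
  have w0 : q - qs != 0 by rewrite subr_eq0; apply/eqP.
  have W0 := enorm2_gt0 w0.
  have al := alpha_le _ Nalpha.
  have a2L4 : 0 <= par_a p ^+ 2 / par_L p ^+ 4.
    by rewrite divr_ge0 ?sqr_ge0// exprn_ge0// ltW.
  have PB : mxnorm1 (Ppar *m alpha *m Pperp (point3 (0, 0) (par_L p) - xs)) <= B * Abar.
    apply: (le_trans (hB _ _ _)); first exact: unit_vec.
    by rewrite ler_pM2l.
  have T_le := norm_kirchhoff_le CN0 hCN k0 L0 a0 W0 rem0 Co0 B0 Ck0 Abar0 Z0 ZL
    (normc_cis _) (hCo _ _ _ a0 (divr_gt0 k0 Z0) w0) PB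
    (remainder_bound _ _ _ _ a2L4 (ltW rem0) (mxnorm1_ge0 _) main al).
  set Kir := kirchhoff _ _ _ _ _ _ in T_le *.
  have u0 : 0 < par_L p / (par_a p * par_k p * enorm2 (q - qs)).
    by rewrite divr_gt0// !mulr_gt0.
  have scale0 : 0 < (4 * pi * par_L p) ^+ 2 * (par_L p ^+ 2 / par_a p ^+ 2).
    by rewrite mulr_gt0 ?divr_gt0 ?exprn_gt0 ?mulr_gt0.
  have T0 := mulr_ge0 (matrix_norm_ge0 hN Kir) (ltW scale0).
  have [E1 [E2 [E1_le E2_le E12]]] := split_error u0 rem0 T0 T_le.
  exists E1, E2; split => //; rewrite E12.
  have rescale (n s l t : R) : s != 0 -> l != 0 -> t != 0 ->
      n = 1 / s ^+ 2 * (t ^+ 2 / l ^+ 2 * (n * (s ^+ 2 * (l ^+ 2 / t ^+ 2)))).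
    by move=> s0 l0 t0; field; rewrite s0 l0 t0.
  by apply: rescale; rewrite gt_eqF// !mulr_gt0.
- move=> eps eps0.
  (* Multiplied by [(4 * pi * L) ^+ 2] and measured in [N], the error of [kirchhoff_approx] is at
     most [C2 * remainder p * (a ^+ 2 / L ^+ 2)]. *)
  pose C2 := CN * (16 * pi ^+ 2 * Ck * Abar).
  have C20 : 0 < C2 by rewrite !mulr_gt0 ?exprn_gt0.
  have rem_small : \forall p \near fraunhofer Ckh, remainder p < eps / C2.
    have /cvgrPdist_lt /(_ _ (divr_gt0 eps0 C20)) := @remainder_cvg0 R Ckh.
    apply: filterS => p; rewrite /= sub0r normrN; exact/le_lt_trans/ler_norm.
  apply: filterS3 (fraunhofer_positive Ckh) hCk rem_small => p [k0 L0 a0 rem0] hp rem_lt /=.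
  move=> xs qs eta alpha xsL qsb etah _ Nalpha.
  have [_ _] := hp xs qs qs eta alpha xsL qsb qsb etah.
  set ystar := point3 qs _; set P := Ppar *m alpha *m _.
  set Kir := kirchhoff _ _ _ _ _ _.
  have -> : cis (par_k p * (enorm3 (ystar - xs) - enorm3 (xs - ystar))) = 1.
    by rewrite -(enorm3N (xs - ystar)) opprB subrr mulr0 cis0.
  have -> : cint (array (par_a p) D) (fun x => cis (par_k p / (par_L p + eta)
      * (x.1 * (qs.1 - qs.1) + x.2 * (qs.2 - qs.2)))) = (area (array (par_a p) D))%:C%C.
    rewrite -cint1; last exact: measurable_array.
    by congr cint; apply/funext => x; rewrite !subrr !mulr0 addr0 mulr0 cis0.
  rewrite mulr1 => main.
  pose X := (4 * pi * par_L p) ^+ 2.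
  have X0 : 0 < X by rewrite exprn_gt0// !mulr_gt0.
  have XX : ((4 * pi * par_L p) ^+ 4)^-1 = X^-1 * X^-1 by rewrite /X -invfM -exprD.
  set kappa := _ * _ in main.
  have Xkappa : X%:C%C * kappa = (area (array (par_a p) D) / X)%:C%C.
    rewrite /kappa XX -!(rmorphM (real_complex R)); congr (_%:C%C).
    by field; rewrite (lt0r_neq0 X0).
  (* Obtained by solving the claimed identity for the error; one of the two factors [X^-1] in
     [kappa] goes to the outer prefactor. *)
  exists (X%:C%C *: (Kir - kappa *: P)); split; last first.
    rewrite -/X scalerBr scalerA Xkappa addrC subrK scalerA.
    by rewrite -(rmorphM (real_complex R)) mul1r mulVf ?scale1r// gt_eqF.
  apply: (le_trans (hCN _)); rewrite mxnorm1Z normc_real gtr0_norm//.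
  apply: (@le_trans _ _ (C2 * remainder p * (par_a p ^+ 2 / par_L p ^+ 2))).
    have -> : C2 * remainder p * (par_a p ^+ 2 / par_L p ^+ 2) =
        CN * (X * (Ck * remainder p * (par_a p ^+ 2 / par_L p ^+ 4) * Abar)).
      by rewrite /C2 /X; field; rewrite (lt0r_neq0 L0).
    rewrite ler_pM2l// ler_pM2l//.
    apply: (remainder_bound _ _ _ _ _ (ltW rem0) (mxnorm1_ge0 _) main (alpha_le _ Nalpha)).
    by rewrite divr_ge0 ?sqr_ge0// exprn_ge0// ltW.
  apply: ler_wpM2r; first by rewrite divr_ge0 ?sqr_ge0.
  by rewrite mulrC -ler_pdivlMr// ltW.
Qed.
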